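(* Let $F\subset\mathbb R^n$ be a closed set, $Y$ a normed linear space, $f\colon F\to Y$ an arbitrary function and $L\colon F\to\mathcal L(\mathbb R^n,Y)$ a function that is Baire one on $F$. Then there exists a function $\bar f\colon\mathbb R^n\to Y$ such that (i) $\bar f=f$ on $F$; (ii) if $a\in F$ and $f$ is continuous at $a$ (with respect to $F$), then $\bar f$ is continuous at $a$; (iii) if $a\in F$, $\alpha\in(0,1]$ and $f$ is $\alpha$-Hölder continuous at $a$ (with respect to $F$), then $\bar f$ is $\alpha$-Hölder continuous at $a$; in particular, if $f$ is Lipschitz at $a$ (with respect to $F$), then $\bar f$ is Lipschitz at $a$; (iv) if $a\in F$ and $L(a)$ is a relative Fréchet derivative of $f$ at $a$ (with respect to $F$), then $(\bar f)'(a)=L(a)$; (v) $\bar f|_{\mathbb R^n\setminus F}\in C^\infty(\mathbb R^n\setminus F,Y)$; (vi) if $a\in F$, $L$ is continuous at $a$ (with respect to $F$) and $L(a)$ is a relative strict derivative of $f$ at $a$ (with respect to $F$), then the Fréchet derivative $(\bar f)'$ is continuous at $a$ with respect to $(\mathbb R^n\setminus F)\cup\{a\}$ and $L(a)$ is the strict derivative of $\bar f$ at $a$ (with respect to $\mathbb R^n$); (vii) if $a\in F$, $R>0$, $L$ is bounded on $B(a,R)\cap F$ and $f$ is Lipschitz continuous on $B(a,R)\cap F$, then $\bar f$ is Lipschitz continuous on $B(a,r)$ for every $r<R$; if $L$ is bounded on $F$ and $f$ is Lipschitz continuous on $F$, then $\bar f$ is Lipschitz continuous on $\mathbb R^n$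.
   Context: $\mathcal L(\mathbb R^n,Y)$ is the normed space of linear maps $\mathbb R^n\to Y$ with operator norm. Baire one means pointwise limit of a sequence of continuous functions. For $A\subset\mathbb R^n$, $g\colon A\to Y$, $a\in A$: $T\in\mathcal L(\mathbb R^n,Y)$ is a relative Fréchet derivative of $g$ at $a$ (w.r.t. $A$) if $a$ is isolated in $A$ or $\lim_{x\to a,x\in A}\|g(x)-g(a)-T(x-a)\|/|x-a|=0$; it is a relative strict derivative at $a$ if $a$ is isolated in $A$ or $\lim \|g(y)-g(x)-T(y-x)\|/|y-x|=0$ as $x\to a$, $y\to a$, $x,y\in A$, $x\ne y$ (with $x=a$ or $y=a$ allowed). For $\alpha\in(0,1]$, $g$ is $\alpha$-Hölder continuous at $a$ (w.r.t. $A$) if $a$ is isolated in $A$ or $\limsup_{x\to a,x\in A}\|g(x)-g(a)\|/|x-a|^\alpha<\infty$; Lipschitz at $a$ means $1$-Hölder at $a$. $B(a,r)$ denotes the open ball. *)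

(* Defs.v *)
From HB Require Import structures.
From mathcomp Require Import all_boot all_order all_algebra.
From mathcomp Require Import all_classical all_reals all_analysis.
Set Implicit Arguments. Unset Strict Implicit. Unset Printing Implicit Defensive.
Import Order.TTheory GRing.Theory Num.Theory.
Import numFieldNormedType.Exports.
Local Open Scope classical_set_scope.
Local Open Scope ring_scope.

Section Defs.
Context {R : realType} {n : nat} {Y : normedModType R}.
Local Notation V := 'rV[R]_n.

Definition enorm (x : V) : R := Num.sqrt (\sum_(i < n) x ord0 i ^+ 2).

Definition eball (a : V) (r : R) : set V := [set x | enorm (x - a) < r].

Definition opnorm (T : V -> Y) : R :=
  sup [set `|T x| | x in [set x : V | enorm x <= 1]].

Definition isolated_in (A : set V) (a : V) : Prop :=
  exists2 r : R, 0 < r & forall x, A x -> enorm (x - a) < r -> x = a.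

Definition cont_at_rel (A : set V) (g : V -> Y) (a : V) : Prop :=
  forall eps : R, 0 < eps -> exists2 d : R, 0 < d &
    forall x, A x -> enorm (x - a) < d -> `|g x - g a| < eps.

Definition opcont_at (A : set V) (M : V -> {linear V -> Y}) (a : V) : Prop :=
  forall eps : R, 0 < eps -> exists2 d : R, 0 < d &
    forall x, A x -> enorm (x - a) < d -> opnorm (fun v => M x v - M a v) < eps.

Definition baire_one_on (F : set V) (L : V -> {linear V -> Y}) : Prop :=
  exists Lk : nat -> V -> {linear V -> Y},
    (forall k a, F a -> opcont_at F (Lk k) a) /\
    (forall x, F x -> forall eps : R, 0 < eps -> exists N : nat,
       forall k, (N <= k)%N -> opnorm (fun v => Lk k x v - L x v) < eps).

Definition frechet_at (A : set V) (g : V -> Y) (a : V) (T : {linear V -> Y}) : Prop :=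
  isolated_in A a \/
  forall eps : R, 0 < eps -> exists2 d : R, 0 < d &
    forall x, A x -> 0 < enorm (x - a) < d ->
      `|g x - g a - T (x - a)| / enorm (x - a) < eps.

Definition strict_at (A : set V) (g : V -> Y) (a : V) (T : {linear V -> Y}) : Prop :=
  isolated_in A a \/
  forall eps : R, 0 < eps -> exists2 d : R, 0 < d &
    forall x y, A x -> A y -> x != y -> enorm (x - a) < d -> enorm (y - a) < d ->
      `|g y - g x - T (y - x)| / enorm (y - x) < eps.

Definition holder_at (A : set V) (g : V -> Y) (a : V) (alpha : R) : Prop :=
  isolated_in A a \/
  exists C : R, exists2 d : R, 0 < d &
    forall x, A x -> 0 < enorm (x - a) < d ->
      `|g x - g a| / (enorm (x - a) `^ alpha) <= C.

Definition lip_at_pt (A : set V) (g : V -> Y) (a : V) : Prop := holder_at A g a 1.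

Definition lip_on_set (S : set V) (g : V -> Y) : Prop :=
  exists C : R, forall x y, S x -> S y -> `|g x - g y| <= C * enorm (x - y).

Definition op_bounded_on (S : set V) (L : V -> {linear V -> Y}) : Prop :=
  exists M : R, forall x, S x -> opnorm (L x) <= M.

Fixpoint iter_dderiv (vs : seq V) (g : V -> Y) : V -> Y :=
  match vs with
  | [::] => g
  | v :: vs' => fun x => derive (iter_dderiv vs' g) x v
  end.

Definition smooth_on_open (U : set V) (g : V -> Y) : Prop :=
  forall vs : seq V,
    (forall x, U x -> forall v, derivable (iter_dderiv vs g) x v) /\
    (forall x, U x -> {for x, continuous (iter_dderiv vs g)}).

End Defs.

(* Main.v *)
(* Off [F] the extension is a Whitney-type sum
     fbar x = \sum_j w_j(x) (f(p_j) + A_j (x - p_j)),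
   with [p_j] a point of [F] close to the support of [w_j], which has size about
   [d_j]. The operators [A_j] must converge to [L a] as [x -> a] non-tangentially,
   while tangentially only |A_j - L a| d_j = o(|x - a|) is needed; this
   follows from the Baire one property. One takes [A_j = L q_j], with [q_j] near
   [p_j], such that some member of the approximating sequence of index at least
   [k] is [1/k]-close to [L q_j] on the ball of radius [k d_j] around [p_j],
   with [k] as large as possible subject to |L q_j| <= sqrt k. As [A_j] is a value of [L]
   near [a] (or zero, when [L] is large near [p_j]), bounds and continuity of [L] pass
   to the [A_j].
   The strict derivative and the Lipschitz bounds come from a single estimate
   of fbar - T, [T] linear, on pairs of points: if they are closer than
   their distance to [F] one uses the Lipschitz constants of the weights,
   otherwise one passes through points of [F]. In particular no derivative of
   [fbar] has to be computed: its continuity follows from strictness. *)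
Require Import Defs.
From HB Require Import structures.
From mathcomp Require Import all_boot all_order all_algebra.
From mathcomp Require Import all_classical all_reals all_analysis.
From mathcomp Require Import ring lra.
Import Order.TTheory GRing.Theory Num.Theory.
Import numFieldNormedType.Exports.
Local Open Scope classical_set_scope.
Local Open Scope ring_scope.
Set Implicit Arguments. Unset Strict Implicit. Unset Printing Implicit Defensive.

(** * Euclidean and operator norms *)

(** The obstacle: [L] may be unbounded near [a], and the members of the approximating sequence are
    continuous at [a] with no uniformity, whereas [A_j] is chosen from [p_j] and [d_j] alone.
    Maximality of the level settles this, because [a] itself is a candidate at any fixed large level
    [K] once [|p_j - a| <= (K+1) d_j] and [d_j] is small. So let [k] be the chosen level. If
    [|p_j - a| <= (k+1) d_j], then [k >= K], and one member of the sequence is close at [a] both to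
    [A_j] and to [L a]. Otherwise [|p_j - a|] exceeds both [(k+1) d_j] and [(K+1) d_j], and since
    [|A_j| <= sqrt (k+1)] the product [|A_j| d_j] is small against [|p_j - a|]. The scales come from
    [s = d_j^(1/4)]: candidates are sought within [s^2], and without an available level the norm of
    [A_j] is capped near [1/s], as [s^4 / s = s^3] is negligible against [s^2]. The weights are
    [eta_j] times the product of the earlier [1 - eta_i]; having no quotient, they stay in an
    algebra generated by coordinates and flat functions and closed under differentiation. *)

Section Euclidean.
Context {R : realType} {n : nat}.
Implicit Types x y z : 'rV[R]_n.

Lemma enorm_ge0 x : 0 <= enorm x.
Proof. exact: sqrtr_ge0. Qed.

Lemma enorm_sqr x : enorm x ^+ 2 = \sum_(i < n) x ord0 i ^+ 2.
Proof. by rewrite sqr_sqrtr // sumr_ge0 // => i _; exact: sqr_ge0. Qed.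

Lemma enormZ (c : R) x : enorm (c *: x) = `|c| * enorm x.
Proof.
rewrite /enorm -sqrtr_sqr -sqrtrM ?sqr_ge0// mulr_sumr.
by congr Num.sqrt; apply: eq_bigr => i _; rewrite mxE exprMn.
Qed.

Lemma enormN x : enorm (- x) = enorm x.
Proof. by rewrite -scaleN1r enormZ normrN normr1 mul1r. Qed.

Lemma enormC x y : enorm (x - y) = enorm (y - x).
Proof. by rewrite -enormN opprB. Qed.

Lemma enorm0 : enorm (0 : 'rV[R]_n) = 0.
Proof. by rewrite -(scale0r 0) enormZ normr0 mul0r. Qed.

Lemma coord_le_enorm x i : `|x ord0 i| <= enorm x.
Proof.
rewrite -sqrtr_sqr ler_sqrt ?sumr_ge0// => [|j _]; last exact: sqr_ge0.
by rewrite (bigD1 i)//= lerDl sumr_ge0// => j _; exact: sqr_ge0.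
Qed.

Lemma enorm_le_sum x : enorm x <= \sum_(i < n) `|x ord0 i|.
Proof.
have h : forall s : seq 'I_n, 0 <= \sum_(i <- s) `|x ord0 i| /\
  \sum_(i <- s) x ord0 i ^+ 2 <= (\sum_(i <- s) `|x ord0 i|) ^+ 2.
  elim=> [|i s [h0 hs]]; first by rewrite !big_nil expr0n.
  rewrite !big_cons; split; first by rewrite addr_ge0.
  rewrite sqrrD real_normK ?num_real//.
  have : 0 <= `|x ord0 i| * \sum_(i <- s) `|x ord0 i| by rewrite mulr_ge0.
  by rewrite mulr2n => ?; lra.
have [h0 hs] := h (index_enum 'I_n).
by rewrite -(ger0_norm h0) -sqrtr_sqr ler_wsqrtr.
Qed.

Lemma enorm_eq0 x : enorm x = 0 -> x = 0.
Proof.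
move=> x0; apply/rowP => i; rewrite mxE; apply/eqP.
by rewrite -normr_le0 -x0 coord_le_enorm.
Qed.

Lemma enorm_gt0 x y : x != y -> 0 < enorm (x - y).
Proof.
move=> xy; rewrite lt_neqAle enorm_ge0 andbT eq_sym.
by apply: contra xy => /eqP/enorm_eq0/eqP; rewrite subr_eq0.
Qed.

(* Lagrange's identity: [2 (|x|^2 |y|^2 - <x,y>^2)] is the sum of the squares
   [(x_i y_j - x_j y_i)^2]. *)
Lemma cauchy_schwarz x y :
  \sum_(i < n) x ord0 i * y ord0 i <= enorm x * enorm y.
Proof.
apply: (le_trans (ler_norm _)).
rewrite -sqrtr_sqr /enorm -sqrtrM; last first.
  by rewrite sumr_ge0// => i _; exact: sqr_ge0.
apply: ler_wsqrtr.
have : 0 <= \sum_(i < n) \sum_(j < n)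
   (x ord0 i * y ord0 j - x ord0 j * y ord0 i) ^+ 2.
  by rewrite sumr_ge0// => i _; rewrite sumr_ge0// => j _; exact: sqr_ge0.
have -> : \sum_(i < n) \sum_(j < n)
   (x ord0 i * y ord0 j - x ord0 j * y ord0 i) ^+ 2 =
   \sum_(i < n) \sum_(j < n) (x ord0 i ^+ 2 * y ord0 j ^+ 2) +
   \sum_(i < n) \sum_(j < n) (y ord0 i ^+ 2 * x ord0 j ^+ 2) -
   2 * \sum_(i < n) \sum_(j < n) (x ord0 i * y ord0 i) * (x ord0 j * y ord0 j).
  rewrite mulr_sumr -big_split -sumrB /=; apply: eq_bigr => i _.
  rewrite mulr_sumr -big_split -sumrB /=; apply: eq_bigr => j _.
  by ring.
rewrite -!big_distrlr /=; set a := \sum_(i < n) _; set b := \sum_(i < n) _.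
by set c := \sum_(i < n) _; rewrite expr2 => ?; nra.
Qed.

Lemma enormD x y : enorm (x + y) <= enorm x + enorm y.
Proof.
rewrite -ler_sqr ?nnegrE ?addr_ge0 ?enorm_ge0//.
rewrite sqrrD !enorm_sqr.
have := cauchy_schwarz x y.
have -> : \sum_(i < n) (x + y) ord0 i ^+ 2 = \sum_(i < n) x ord0 i ^+ 2 +
    (\sum_(i < n) x ord0 i * y ord0 i) *+ 2 + \sum_(i < n) y ord0 i ^+ 2.
  rewrite -sumrMnl -!big_split /=; apply: eq_bigr => i _.
  by rewrite mxE sqrrD.
rewrite !mulr2n; lra.
Qed.

Lemma enorm_tri y x z : enorm (x - z) <= enorm (x - y) + enorm (y - z).
Proof. by have := enormD (x - y) (y - z); rewrite addrA subrK. Qed.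

(** Neighbourhoods are taken in the max norm of matrices; this bound and [enorm_le_norm] convert
    between the two norms. *)
Lemma norm_le_enorm x : `|x| <= enorm x.
Proof.
rewrite /Num.norm/= mx_normrE; apply/bigmax_leP; split=> [|[i j] _ /=].
  exact: enorm_ge0.
by rewrite ord1 coord_le_enorm.
Qed.

Lemma coord_le_norm x i : `|x ord0 i| <= `|x|.
Proof. 
rewrite /Num.norm/= mx_normrE.
exact: (le_bigmax _ (fun ij => `|x ij.1 ij.2|) (ord0, i)).
Qed.

Lemma enorm_le_norm x : enorm x <= n%:R * `|x|.
Proof.
apply: (le_trans (enorm_le_sum x)).
rewrite -[n in n%:R]card_ord -sum1_card natr_sum mulr_suml.
by apply: ler_sum => i _; rewrite mul1r coord_le_norm.
Qed.

End Euclidean.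

Section OperatorNorm.
Context {R : realType} {n : nat} {Y : normedModType R}.
Local Notation V := 'rV[R]_n.
Implicit Types T : V -> Y.

Lemma linear_bounded (T : {linear V -> Y}) :
  exists2 M : R, 0 <= M & forall v, `|T v| <= M * enorm v.
Proof.
exists (\sum_(i < n) `|T (delta_mx ord0 i)|); first exact: sumr_ge0.
move=> v; rewrite {1}(row_sum_delta v) linear_sum mulr_suml.
apply: (le_trans (ler_norm_sum _ _ _)); apply: ler_sum => i _.
by rewrite linearZ /= normrZ mulrC ler_wpM2l// coord_le_enorm.
Qed.

(** [linear_bounded] makes the set under the supremum bounded above, so that [sup] is a genuine
    upper bound; scaling to the unit ball reaches the other vectors. *)
Lemma opnorm_le (T : {linear V -> Y}) (c : R) : opnorm T <= c ->
  forall v, `|T v| <= c * enorm v.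
Proof.
move=> Tc v; have [M M0 TM] := linear_bounded T.
have [v0|v0] := eqVneq v 0; first by rewrite v0 linear0 normr0 enorm0 mulr0.
have ev : 0 < enorm v by have := enorm_gt0 v0; rewrite subr0.
apply: le_trans (ler_wpM2r (ltW ev) Tc).
rewrite -ler_pdivrMr//; apply: ub_le_sup.
  exists M => _ [x /= x1 <-]; apply: (le_trans (TM x)).
  by rewrite ler_piMr.
exists ((enorm v)^-1 *: v).
  by rewrite /= enormZ gtr0_norm ?invr_gt0// mulVf// gt_eqF.
by rewrite linearZ normrZ gtr0_norm ?invr_gt0// mulrC.
Qed.

Lemma le_opnorm (T : V -> Y) (c : R) : 0 <= c ->
  (forall v, `|T v| <= c * enorm v) -> opnorm T <= c.
Proof.
move=> c0 Tc; apply: ge_sup => [|_ [x /= x1 <-]].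
  by exists `|T 0|, 0 => //=; rewrite enorm0.
by apply: (le_trans (Tc x)); rewrite ler_piMr.
Qed.

Lemma opnorm_sub_le (M N : {linear V -> Y}) (c : R) :
  opnorm (fun v => M v - N v) <= c ->
  forall v, `|M v - N v| <= c * enorm v.
Proof. exact: (opnorm_le (T := (M \- N))). Qed.

End OperatorNorm.

(** * Smooth functions *)

Section FlatFunctions.
Context {R : realType}.
Implicit Types t : R.

(* For [m = 0] this is the classical flat function; the factor [t ^- m] makes
   the family closed, up to linear combinations, under differentiation. *)
Definition flat (m : nat) (t : R) : R :=
  if 0 < t then t^-1 ^+ m * expR (- t^-1) else 0.

(** For [m > 0] this is the [m]-th power of [y / m <= expR (y / m)]. *)
Lemma exp_decay (m : nat) (y : R) : 0 <= y ->
  y ^+ m * expR (- y) <= m%:R ^+ m.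
Proof.
move=> y0; rewrite expRN ler_pdivrMr ?expR_gt0//.
case: m => [|m]; first by rewrite !expr0 mul1r -expR0 ler_expR.
have m0 : (0 : R) < m.+1%:R by rewrite ltr0n.
rewrite -{2}[y](divfK (lt0r_neq0 m0)) expRM_natr -exprMn.
apply: lerXn2r; rewrite ?nnegrE ?divr_ge0 ?expR_ge0//.
rewrite -ler_pdivrMl// mulrC; apply: le_trans (expR_ge1Dx _).
by rewrite lerDr.
Qed.

Lemma flat_ge0 m t : 0 <= flat m t.
Proof.
rewrite /flat; case: ifP => // t0.
by rewrite mulr_ge0 ?expR_ge0// exprn_ge0// invr_ge0 ltW.
Qed.

Lemma flat_le m t : flat m t <= m%:R ^+ m.
Proof.
rewrite /flat; case: ifP => t0; last by rewrite exprn_ge0.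
by rewrite exp_decay// invr_ge0 ltW.
Qed.

Lemma flat_le0 m t : t <= 0 -> flat m t = 0.
Proof. by rewrite /flat ltNge => ->. Qed.

Lemma flatS m t : flat m.+1 t = t^-1 * flat m t.
Proof. by rewrite /flat; case: ifP => t0; rewrite ?mulr0// exprS mulrA. Qed.

(** Away from 0 the function is locally constant or a composite. At 0 the difference quotient is
    [flat m.+1 s], which for [s > 0] is [s * flat m.+2 s], at most a constant times [s]. *)
Lemma is_derive_flat m t :
  is_derive t (1 : R) (flat m) (flat m.+2 t - m%:R * flat m.+1 t).
Proof.
have [t0|t0|->] := ltgtP t 0.
- rewrite !flat_le0 ?ltW// mulr0 subr0.
  apply: near_eq_is_derive (is_derive_cst 0 t 1).
  near=> s; rewrite flat_le0 ?ltW//.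
  by near: s; exact: lt_nbhsl.
- have nt : t != 0 by rewrite gt_eqF.
  apply: (@near_eq_is_derive _ _ _
    ((fun y : R => y ^+ m * expR (- y)) \o (fun s : R => s^-1))).
    near=> s; rewrite /= /flat.
    by rewrite ifT//; near: s; exact: lt_nbhsr.
  have d1 : is_derive t (1 : R) (fun s : R => s^-1) (- t ^- 2).
    have := is_deriveV (f := id) nt (is_derive_id t 1); move/is_derive_eq; apply.
    by rewrite /GRing.scale /= mulr1.
  have d2 : is_derive (t^-1) (1 : R) (fun y : R => y ^+ m * expR (- y))
     (m%:R * t^-1 ^+ m.-1 * expR (- t^-1) - t^-1 ^+ m * expR (- t^-1)).
    have dN : is_derive (t^-1) (1 : R) (fun y : R => expR (- y)) (- expR (- t^-1)).
      have := @is_derive1_comp _ expR (fun y => - y) (t^-1) _ _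
        (is_derive_expR _) (is_deriveNid (t^-1) 1).
      by rewrite mulrN1.
    have dX : is_derive (t^-1) (1 : R) (fun y : R => y ^+ m) (m%:R * t^-1 ^+ m.-1).
      have := is_deriveX (f := id) m (is_derive_id (t^-1) 1).
      rewrite (_ : id ^+ m = (fun y : R => y ^+ m)); last first.
        by apply/funext => y; rewrite exprfctE.
      by move/is_derive_eq; apply; rewrite /GRing.scale /= mulr1 mulr_natl.
    have := is_deriveM dX dN; move/is_derive_eq; apply.
    by rewrite /GRing.scale /=; ring.
  have := is_derive1_comp d2 d1; move/is_derive_eq; apply.
  rewrite /flat t0 -exprVn; set y := t^-1; case: m {d2} => [|m] /=.
    by rewrite !expr0; ring.
  by rewrite !exprS; ring.
rewrite !flat_le0// mulr0 subr0.
have cv : (fun s : R => s^-1 *: (flat m (s *: 1 + 0) - flat m 0))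
    @ (0 : R)^' --> (0 : R).
  apply/cvgrPdist_le => /= e e0.
  pose c : R := (m.+2)%:R ^+ m.+2.
  have c0 : 0 < c by rewrite exprn_gt0// ltr0n.
  near=> s; rewrite addr0 (flat_le0 _ (lexx 0)) subr0 sub0r normrN.
  rewrite /GRing.scale /= mulr1 -flatS ger0_norm ?flat_ge0//.
  have [s0|s0] := leP s 0; first by rewrite flat_le0// ltW.
  have -> : flat m.+1 s = s * flat m.+2 s.
    by rewrite (flatS m.+1) mulrA divff ?gt_eqF// mul1r.
  apply: (@le_trans _ _ (s * c)).
    by rewrite ler_wpM2l ?flat_le// ltW.
  rewrite -ler_pdivlMr//; apply: (le_trans (ler_norm _)); apply: ltW.
  by near: s; apply: dnbhs0_lt; rewrite divr_gt0.
split; first by apply/cvg_ex; exists 0.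
exact: cvg_lim.
Unshelve. all: by end_near. Qed.

End FlatFunctions.

Section SmoothAlgebra.
Context {R : realType} {n : nat}.
Local Notation V := 'rV[R]_n.

(** A class of functions closed under directional derivatives and rich enough for cut-offs:
    smoothness of every order then costs a single differentiation step. *)
Inductive flat_algebra : (V -> R) -> Prop :=
| flat_algebra_cst c : flat_algebra (fun _ => c)
| flat_algebra_coord i : flat_algebra (fun x => x ord0 i)
| flat_algebraD f g : flat_algebra f -> flat_algebra g ->
    flat_algebra (fun x => f x + g x)
| flat_algebraM f g : flat_algebra f -> flat_algebra g ->
    flat_algebra (fun x => f x * g x)
| flat_algebra_flat m f : flat_algebra f -> flat_algebra (fun x => flat m (f x)).

Lemma flat_algebra_prod (I : Type) (s : seq I) (P : pred I) (f : I -> V -> R) :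
  (forall i, flat_algebra (f i)) ->
  flat_algebra (fun x => \prod_(i <- s | P i) f i x).
Proof.
move=> fE; elim: s => [|i s IH].
  by under eq_fun do rewrite big_nil; exact: flat_algebra_cst.
under eq_fun do rewrite big_cons.
by case: (P i) => //; exact: flat_algebraM.
Qed.

Lemma derive_coord (i : 'I_n) (x v : V) :
  'D_v (fun y : V => y ord0 i) x = v ord0 i.
Proof.
apply/lim_near_cst => //=; near=> h.
rewrite !mxE addrK /GRing.scale /= mulKf//.
by near: h; exact: nbhs_dnbhs_neq.
Unshelve. all: by end_near. Qed.

(** The chain rule for [flat m] produces [flat m.+1] and [flat m.+2], which is why all powers [m]
    are generators. *)
Lemma flat_algebra_derive (f : V -> R) : flat_algebra f ->
  (forall x, differentiable f x) /\
  forall v, exists2 f', flat_algebra f' & forall x, 'D_v f x = f' x.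
Proof.
elim=> {f} [c|i|f g _ [df Df] _ [dg Dg]|f g fE [df Df] gE [dg Dg]|m f fE [df Df]].
- split=> [x|v]; first exact: differentiable_cst.
  exists (fun=> 0); first exact: flat_algebra_cst.
  by move=> x; rewrite derive_cst.
- split=> [x|v]; first exact: differentiable_coord.
  exists (fun=> v ord0 i); first exact: flat_algebra_cst.
  by move=> x; rewrite derive_coord.
- split=> [x|v]; first exact: differentiableD.
  have [f' f'E Ef] := Df v; have [g' g'E Eg] := Dg v.
  exists (fun x => f' x + g' x); first exact: flat_algebraD.
  by move=> x; rewrite deriveD ?Ef ?Eg//; exact: diff_derivable.
- split=> [x|v]; first exact: differentiableM.
  have [f' f'E Ef] := Df v; have [g' g'E Eg] := Dg v.
  exists (fun x => f x * g' x + g x * f' x).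
    by apply: flat_algebraD; apply: flat_algebraM.
  by move=> x; rewrite deriveM ?Ef ?Eg//; exact: diff_derivable.
- have dF y : differentiable (flat m : R -> R) y.
    by apply/derivable1_diffP; have [] := is_derive_flat m y.
  split=> [x|v]; first exact: differentiable_comp.
  have [f' f'E Ef] := Df v.
  exists (fun x => (flat m.+2 (f x) + - m%:R * flat m.+1 (f x)) * f' x).
    apply: flat_algebraM => //; apply: flat_algebraD; first exact: flat_algebra_flat.
    by apply: flat_algebraM; [exact: flat_algebra_cst|exact: flat_algebra_flat].
  move=> x; rewrite deriveE; last exact: differentiable_comp.
  rewrite (diff_comp (df x) (dF _)) /=.
  have -> : 'd f x v = f' x by rewrite -Ef deriveE.
  rewrite diff1E// derive1E.
  have [_ ->] := is_derive_flat m (f x).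
  by rewrite /GRing.scale /= mulrC mulNr.
Qed.

Context {Y : normedModType R}.

(** An element of the tensor product of the algebra with [Y], as a list of pure tensors; closure
    under derivatives thus passes to vector-valued functions. *)
Definition flat_combination (s : seq ((V -> R) * Y)) (x : V) : Y :=
  \sum_(p <- s) p.1 x *: p.2.

Lemma flat_combination_derive (s : seq ((V -> R) * Y)) :
  (forall p, List.In p s -> flat_algebra p.1) ->
  (forall x, differentiable (flat_combination s) x) /\
  forall v, exists2 s', (forall p, List.In p s' -> flat_algebra p.1) &
    forall x, 'D_v (flat_combination s) x = flat_combination s' x.
Proof.
elim: s => [_|[f y] s IH sE].
  have -> : flat_combination [::] = cst 0.
    by apply/funext => x; rewrite /flat_combination big_nil.
  split=> [x|v]; first exact: differentiable_cst.
  exists [::] => // x.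
  by rewrite derive_cst /flat_combination big_nil.
have [ds Ds] := IH (fun p ps => sE p (or_intror ps)).
have fE : flat_algebra f by apply: (sE (f, y)); left.
have [df Df] := flat_algebra_derive fE.
have -> : flat_combination ((f, y) :: s) =
    (fun x => f x *: y) + flat_combination s.
  by apply/funext => x; rewrite /flat_combination big_cons.
have dfy x : differentiable (fun x => f x *: y) x by exact: differentiableZl.
split=> [x|v]; first exact: differentiableD.
have [f' f'E Ef] := Df v; have [s' s'E Es] := Ds v.
exists ((f', y) :: s') => [p [<-//|]|x]; first exact: s'E.
rewrite deriveD; [|exact: diff_derivable|exact: diff_derivable].
rewrite Es /flat_combination big_cons /=; congr (_ + _).
by rewrite deriveE// diffZl// -Ef deriveE.
Qed.

Definition is_flat_combination (g : V -> Y) : Prop :=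
  exists2 s, (forall p, List.In p s -> flat_algebra p.1) &
    forall x, g x = flat_combination s x.

Lemma is_flat_combination_sum (I : Type) (r : seq I) (g : I -> V -> Y) :
  (forall i, is_flat_combination (g i)) ->
  is_flat_combination (fun x => \sum_(i <- r) g i x).
Proof.
move=> gE; elim: r => [|i r [s sE Es]].
  by exists [::] => // x; rewrite /flat_combination !big_nil.
have [t tE Et] := gE i.
suff [u uE Eu] : exists2 u, (forall p, List.In p u -> flat_algebra p.1) &
    forall x, flat_combination u x = flat_combination t x + flat_combination s x.
  by exists u => // x; rewrite big_cons Et Es Eu.
elim: t tE {gE Et} => [_|q t IH tE].
  by exists s => // x; rewrite {2}/flat_combination big_nil add0r.
have [u uE Eu] := IH (fun p pt => tE p (or_intror pt)).
exists (q :: u) => [p [<-|pu]|x].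
- by apply: tE; left.
- exact: uE.
by move: (Eu x); rewrite /flat_combination !big_cons -addrA => ->.
Qed.

Lemma is_flat_combination_term (f : V -> R) (y : Y) :
  flat_algebra f -> is_flat_combination (fun x => f x *: y).
Proof.
move=> fE; exists [:: (f, y)] => [p [<-//|[]]|x].
by rewrite /flat_combination big_seq1.
Qed.

(** Derivatives are local and those of a combination are combinations, so induction on the list of
    directions keeps every iterated derivative locally equal to a combination. *)
Lemma smooth_of_flat_combination (U : set V) (g : V -> Y) : open U ->
  (forall x, U x -> exists2 h, is_flat_combination h &
    \forall y \near x, g y = h y) ->
  smooth_on_open U g.
Proof.
move=> oU gU vs.
have {}gU : forall x, U x -> exists2 s,
    (forall p, List.In p s -> flat_algebra p.1) &
    \forall y \near x, iter_dderiv vs g y = flat_combination s y.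
  elim: vs => [x /gU[h [s sE hs] gh]|v vs IH x Ux].
    by exists s => //; apply: filterS gh => y /= ->; exact: hs.
  have [s sE gs] := IH x Ux.
  have [_ Ds] := flat_combination_derive sE.
  have [s' s'E Es] := Ds v; exists s' => //.
  have /nbhs_interior := gs; apply: filterS => y gy /=; rewrite -Es.
  exact: near_eq_derive.
split=> x Ux.
- move=> v; have [s sE gs] := gU x Ux.
  have [ds _] := flat_combination_derive sE.
  have : derivable (flat_combination s) x v by exact: diff_derivable.
  apply: near_eq_derivable.
  by apply: filterS gs => y ->.
- have [s sE gs] := gU x Ux.
  have [ds _] := flat_combination_derive sE.
  have := differentiable_continuous (ds x).
  rewrite /prop_for /continuous_at (nbhs_singleton gs) => h.
  apply: cvg_trans h; apply: (@near_eq_cvg _ _ (nbhs x)).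
  by move: gs; apply: filterS => y ->.
Qed.

End SmoothAlgebra.

(** * Cut-off functions and sequential partitions of unity *)

Section Cutoff.
Context {R : realType}.
Implicit Types t : R.

(** Mean value theorem: the derivative of [flat 0] is [flat 2], and 4 is its bound [2 ^+ 2]. *)
Lemma flat0_lip (a b : R) : `|flat 0 a - flat 0 b| <= 4 * `|a - b|.
Proof.
wlog ab : a b / a < b.
  move=> h; have [|ba|->] := ltgtP a b; first exact: h.
    by rewrite distrC (distrC a) h.
  by rewrite !subrr normr0 mulr0.
have D (x : R) : is_derive x (1 : R) (flat 0) (flat 2 x).
  by have := is_derive_flat 0 x; rewrite mul0r subr0.
have cont : {within `[a, b], continuous (flat 0 : R -> R)}.
  apply: continuous_subspaceT => x; apply: differentiable_continuous.
  by apply/derivable1_diffP; have [] := D x.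
have [c _ E] := MVT ab (fun x _ => D x) cont.
rewrite distrC E normrM (distrC a) ler_wpM2r// ger0_norm ?flat_ge0//.
by apply: (le_trans (flat_le 2 c)); rewrite expr2 -natrM.
Qed.

(* Equal to 1 for [t <= 0] and to 0 for [1 <= t], by composing [flat 0] with
   itself instead of taking a quotient. *)
Definition step t : R := expR 1 * flat 0 (1 + - expR 1 * flat 0 t).

Lemma step_le0 t : t <= 0 -> step t = 1.
Proof.
move=> t0; rewrite /step (flat_le0 _ t0) mulr0 addr0 /flat ltr01 expr0 mul1r.
by rewrite invr1 -expRD subrr expR0.
Qed.

Lemma step_ge1 t : 1 <= t -> step t = 0.
Proof.
move=> t1; rewrite /step flat_le0 ?mulr0//.
rewrite mulNr subr_le0 /flat (lt_le_trans ltr01 t1) expr0 mul1r -expRD.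
rewrite -[leLHS]expR0 ler_expR subr_ge0 invf_le1//.
exact: lt_le_trans ltr01 t1.
Qed.

Lemma step_ge0 t : 0 <= step t.
Proof. by rewrite mulr_ge0 ?expR_ge0 ?flat_ge0. Qed.

Lemma step_le1 t : step t <= 1.
Proof.
rewrite /step; set u := 1 + _.
have u1 : u <= 1.
  by rewrite /u mulNr gerBl mulr_ge0 ?expR_ge0 ?flat_ge0.
rewrite /flat; case: ifPn => [u0|_]; last by rewrite mulr0.
by rewrite expr0 mul1r -expRD -[leRHS]expR0 ler_expR subr_le0 invf_ge1.
Qed.

Lemma step_lip : exists2 c : R, 0 <= c &
  forall a b, `|step a - step b| <= c * `|a - b|.
Proof.
pose e : R := expR 1; have e0 : 0 <= e by exact: expR_ge0.
exists (e * (4 * (e * 4))) => [|a b]; first by rewrite !mulr_ge0.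
rewrite /step -/e -mulrBr normrM ger0_norm// -!mulrA ler_wpM2l//.
apply: (le_trans (flat0_lip _ _)); rewrite ler_wpM2l//.
rewrite opprD addrACA subrr add0r -mulrBr normrM normrN (ger0_norm e0).
by rewrite ler_wpM2l// flat0_lip.
Qed.

(** A plateau: 1 on [-1, 1] and 0 off [-2, 2]. The sums are spelled [+ -1] and [-1 *] to match the
    constructors of [flat_algebra]. *)
Definition cutoff t : R := step (t + -1) * step (-1 * t + -1).

Lemma cutoff_eq1 t : `|t| <= 1 -> cutoff t = 1.
Proof.
rewrite ler_norml => /andP[h1 h2]; rewrite /cutoff !step_le0 ?mulr1//; lra.
Qed.

Lemma cutoff_neq0 t : cutoff t != 0 -> `|t| <= 2.
Proof.
apply: contraNT; rewrite -ltNge ltr_normr => /orP[h|h]; rewrite /cutoff.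
  by rewrite (step_ge1 (t := t + -1)) ?mul0r//; lra.
by rewrite (step_ge1 (t := -1 * t + -1)) ?mulr0//; lra.
Qed.

Lemma cutoff_ge0 t : 0 <= cutoff t.
Proof. by rewrite mulr_ge0 ?step_ge0. Qed.

Lemma cutoff_le1 t : cutoff t <= 1.
Proof. by rewrite mulr_ile1 ?step_ge0 ?step_le1. Qed.

Lemma dist_mul_le1 (a b c d : R) : 0 <= a <= 1 -> 0 <= d <= 1 ->
  `|a * b - c * d| <= `|b - d| + `|a - c|.
Proof.
move=> /andP[a0 a1] /andP[d0 d1].
have -> : a * b - c * d = a * (b - d) + (a - c) * d by ring.
apply: (le_trans (ler_normD _ _)); rewrite !normrM.
by apply: lerD; [rewrite ler_piMl// ger0_norm|rewrite ler_piMr// ger0_norm].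
Qed.

Lemma cutoff_lip : exists2 c : R, 0 <= c &
  forall a b, `|cutoff a - cutoff b| <= c * `|a - b|.
Proof.
have [c c0 cL] := step_lip; exists (c + c) => [|a b]; first by rewrite addr_ge0.
apply: (le_trans (dist_mul_le1 _ _ _ _)); rewrite ?step_ge0 ?step_le1//.
rewrite mulrDl; apply: lerD; apply: (le_trans (cL _ _)); rewrite ler_wpM2l//.
  have -> : -1 * a + -1 - (-1 * b + -1) = - (a - b) by ring.
  by rewrite normrN.
by have -> : a + -1 - (b + -1) = a - b by ring.
Qed.

Lemma prodr_01 (I : Type) (s : seq I) (f : I -> R) :
  (forall i, 0 <= f i <= 1) -> 0 <= \prod_(i <- s) f i <= 1.
Proof.
move=> f01; elim: s => [|i s /andP[? ?]]; first by rewrite big_nil ler01 lexx.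
by have /andP[? ?] := f01 i; rewrite big_cons mulr_ge0// mulr_ile1.
Qed.

Lemma dist_prod_le1 (I : Type) (s : seq I) (f g : I -> R) :
  (forall i, 0 <= f i <= 1) -> (forall i, 0 <= g i <= 1) ->
  `|\prod_(i <- s) f i - \prod_(i <- s) g i| <= \sum_(i <- s) `|f i - g i|.
Proof.
move=> f01 g01; elim: s => [|i s IH]; first by rewrite !big_nil subrr normr0.
rewrite !big_cons.
apply: (le_trans (dist_mul_le1 _ _ (f01 i) (prodr_01 _ g01))).
by rewrite addrC lerD2l.
Qed.

End Cutoff.

(** Weights are summed over lists attached to points; this exchanges two such lists when both
    contain the support. *)
Lemma big_uniq_support (Z : zmodType) (I : eqType) (s t : seq I) (f : I -> Z) :
  uniq s -> uniq t -> (forall i, i \notin s -> f i = 0) ->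
  (forall i, i \notin t -> f i = 0) ->
  \sum_(i <- s) f i = \sum_(i <- t) f i.
Proof.
have sub (u v : seq I) : (forall i, i \notin v -> f i = 0) ->
    \sum_(i <- u) f i = \sum_(i <- [seq i <- u | i \in v]) f i.
  move=> fv; rewrite big_filter [RHS]big_mkcond /=; apply: eq_bigr => i _.
  by case: ifPn => // /fv.
move=> us ut fs ft; rewrite (sub s t ft) (sub t s fs).
apply: perm_big; apply: uniq_perm; rewrite ?filter_uniq// => i.
by rewrite !mem_filter andbC.
Qed.

Section SequentialPartition.
Context {R : realType} {T : Type}.
Variable eta : nat -> T -> R.
Hypothesis eta01 : forall j x, 0 <= eta j x <= 1.

(** The share that [eta j] takes of what its predecessors leave of 1. The sums telescope and reach 1
    once some [eta j] equals 1. *)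
Definition seq_weight (j : nat) (x : T) : R :=
  eta j x * \prod_(i <- iota 0 j) (1 - eta i x).

Let ceta01 j x : 0 <= 1 - eta j x <= 1.
Proof. by have /andP[? ?] := eta01 j x; apply/andP; split; lra. Qed.

Lemma seq_weight_ge0 j x : 0 <= seq_weight j x.
Proof.
have /andP[? _] := eta01 j x; rewrite mulr_ge0// prodr_ge0// => i _.
by have /andP[] := ceta01 i x.
Qed.

Lemma seq_weight_eq0 j x : eta j x = 0 -> seq_weight j x = 0.
Proof. by rewrite /seq_weight => ->; rewrite mul0r. Qed.

Lemma sum_seq_weight m x :
  \sum_(j <- iota 0 m) seq_weight j x = 1 - \prod_(i <- iota 0 m) (1 - eta i x).
Proof.
elim: m => [|m IH]; first by rewrite !big_nil subrr.
rewrite -addn1 iotaD !big_cat/= !big_seq1 IH add0n /seq_weight; ring.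
Qed.

Lemma seq_weight_sum1 (s : seq nat) (x : T) : uniq s ->
  (forall j, j \notin s -> eta j x = 0) -> (exists j, eta j x = 1) ->
  \sum_(j <- s) seq_weight j x = 1.
Proof.
move=> us sx [j0 ej0].
pose m := (\max_(j <- j0 :: s) j).+1.
have lem j : j \in j0 :: s -> (j < m)%N by move=> js; rewrite ltnS leq_bigmax_seq.
have ws j : j \notin s -> seq_weight j x = 0.
  by move=> /sx/seq_weight_eq0.
rewrite (@big_uniq_support _ _ s (iota 0 m)) ?iota_uniq//.
  have j0m : j0 \in iota 0 m by rewrite mem_iota add0n lem// mem_head.
  rewrite sum_seq_weight (bigD1_seq j0 j0m) ?iota_uniq//=.
  by rewrite ej0 subrr mul0r subr0.
move=> j; rewrite mem_iota add0n /= => jm; apply: ws; apply: contra jm => js.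
by rewrite lem// inE js orbT.
Qed.

(** Factors in [0, 1] make a difference of products at most the sum of the differences of the
    factors, and only factors indexed by [s] change; so the bound does not grow with [j]. *)
Lemma seq_weight_lip (s : seq nat) (x y : T) (c : R) (j : nat) : uniq s ->
  0 <= c ->
  (forall i, i \notin s -> eta i x = 0 /\ eta i y = 0) ->
  (forall i, `|eta i x - eta i y| <= c) ->
  `|seq_weight j x - seq_weight j y| <= (size s)%:R * c.
Proof.
move=> us c0 s0 ec.
apply: (@le_trans _ _ (\sum_(i <- iota 0 j.+1) `|eta i x - eta i y|)).
  rewrite -addn1 iotaD big_cat /= big_seq1 add0n.
  have : 0 <= \prod_(i <- iota 0 j) (1 - eta i y) <= 1 by exact: prodr_01.
  move=> /(dist_mul_le1 _ _ (eta01 j x)) h; apply: (le_trans (h _ _)).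
  rewrite lerD2r; apply: le_trans (dist_prod_le1 _ _ _) _ => //.
  apply: ler_sum => i _; have -> : 1 - eta i x - (1 - eta i y) = - (eta i x - eta i y) by ring.
  by rewrite normrN.
have -> : \sum_(i <- iota 0 j.+1) `|eta i x - eta i y| =
    \sum_(i <- [seq i <- iota 0 j.+1 | i \in s]) `|eta i x - eta i y|.
  rewrite big_filter [RHS]big_mkcond /=; apply: eq_bigr => i _.
  by case: ifPn => // /s0[-> ->]; rewrite subrr normr0.
apply: (@le_trans _ _ (\sum_(i <- [seq i <- iota 0 j.+1 | i \in s]) c)).
  exact: ler_sum.
rewrite big_const_seq count_predT iter_addr_0 -[leLHS]mulr_natl ler_wpM2r//.
rewrite ler_nat; apply: uniq_leq_size; first by rewrite filter_uniq// iota_uniq.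
by move=> i; rewrite mem_filter => /andP[].
Qed.

End SequentialPartition.

(** * Whitney partitions *)

Section Distance.
Context {R : realType} {n : nat}.
Local Notation V := 'rV[R]_n.
Variable F : set V.
Hypothesis F0 : F !=set0.

Definition dist (x : V) : R := inf [set enorm (x - p) | p in F].

Let dist_has_inf x : has_inf [set enorm (x - p) | p in F].
Proof.
have [p Fp] := F0; split; first by exists (enorm (x - p)), p.
by exists 0 => _ [q _ <-]; exact: enorm_ge0.
Qed.

Lemma dist_le x q : F q -> dist x <= enorm (x - q).
Proof. by move=> Fq; apply: ge_inf; [exact: (dist_has_inf x).2|exists q]. Qed.

Lemma le_dist x (c : R) : (forall q, F q -> c <= enorm (x - q)) -> c <= dist x.
Proof.
move=> h; apply: lb_le_inf; first exact: (dist_has_inf x).1.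
by move=> _ [q Fq <-]; exact: h.
Qed.

Lemma dist_lip x y : dist x <= dist y + enorm (x - y).
Proof.
rewrite -lerBlDr; apply: le_dist => q Fq; rewrite lerBlDr addrC.
by apply: (le_trans (dist_le x Fq)); exact: enorm_tri.
Qed.

Lemma dist_gt0 x : closed F -> ~ F x -> 0 < dist x.
Proof.
move=> cF nFx; have : nbhs x (~` F) by apply: open_nbhs_nbhs; split=> //; exact: closed_openC.
move=> /nbhs_ballP[e /= e0 eF]; apply: (lt_le_trans e0).
apply: le_dist => q Fq; rewrite leNgt; apply/negP => qe.
apply: (eF q) => //; rewrite -ball_normE /=.
exact: le_lt_trans (norm_le_enorm _) qe.
Qed.

Lemma near_point x : 0 < dist x -> exists2 p, F p & enorm (x - p) <= 2 * dist x.
Proof.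
move=> d0; have [_ [p Fp <-] h] := inf_adherent d0 (dist_has_inf x).
by exists p => //; move: h; rewrite -/(dist x) => h; lra.
Qed.

End Distance.

(* [w] is a smooth Whitney partition of unity off [F]; [p j] is a point of [F]
   near the support of [w j], which lies at distance about [d j] from [F], and
   [delta] is a lower bound for the distance to [F]. *)
Record whitney (R : realType) (n : nat) (F : set 'rV[R]_n)
    (w : nat -> 'rV[R]_n -> R) (p : nat -> 'rV[R]_n) (d : nat -> R)
    (delta : 'rV[R]_n -> R) (C : R) : Prop := Whitney {
  whitney_ge1 : 1 <= C ;
  whitney_point : forall j, F (p j) ;
  whitney_size : forall j, 0 < d j ;
  whitney_flat : forall j, flat_algebra (w j) ;
  whitney_ge0 : forall j x, 0 <= w j x ;
  whitney_delta_gt0 : forall x, ~ F x -> 0 < delta x ;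
  whitney_delta_le : forall x q, F q -> delta x <= enorm (x - q) ;
  whitney_supp : forall x j, ~ F x -> w j x != 0 ->
    enorm (x - p j) <= C * d j /\ d j <= C * delta x ;
  whitney_local : forall x, ~ F x -> exists s : seq nat,
    [/\ uniq s, (size s)%:R <= C & forall y, enorm (x - y) < delta x / C ->
      [/\ ~ F y, \sum_(j <- s) w j y = 1, forall j, j \notin s -> w j y = 0 &
        forall j, `|w j x - w j y| <= C * (enorm (x - y) / delta x)]] }.

Section WhitneyConstruction.
Context {R : realType} {n : nat}.
Local Notation V := 'rV[R]_n.
Local Notation J := (int * {ffun 'I_n -> int})%type.
Variable F : set V.
Hypothesis closedF : closed F.
Hypothesis F0 : F !=set0.

(** The cell [(k, l)] belongs to the grid of mesh [expR k]; with this base the scale fitting a point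
    is the integer part of a logarithm. *)
Definition radius (a : J) : R := expR a.1%:~R.
Definition center (a : J) : V := \row_i (radius a * (a.2 i)%:~R).

(* [spread] bounds the Euclidean distance, in units of the radius, of the
   support of a bump from its center. *)
Let spread : R := 2 * n%:R.
(** Distance to [F], in radii, at which a cell is wanted: after losing [spread] twice, between
    center and point, at least 4 radii remain. [top] is [far] times the ratio of consecutive meshes,
    so every positive distance lies between [far] and [top] radii for some mesh. *)
Let far : R := 4 * spread + 4.
Let top : R := expR 1 * far.

Definition bump (a : J) (x : V) : R :=
  \prod_(i < n) cutoff ((radius a)^-1 * x ord0 i + - (a.2 i)%:~R).

Definition good (a : J) : Prop :=
  (far - spread) * radius a <= dist F (center a) <= (top + spread) * radius a.

Definition eta (j : nat) (x : V) : R :=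
  if (pickle_inv j : option J) is Some a then (if `[< good a >] then bump a x else 0) else 0.

Let spread0 : 0 <= spread. Proof. by rewrite mulr_ge0. Qed.
Let far_gt0 : 0 < far.
Proof. by rewrite /far; have := spread0; lra. Qed.
Let top_gt0 : 0 < top. Proof. by rewrite mulr_gt0 ?expR_gt0. Qed.

Lemma radius_gt0 a : 0 < radius a. Proof. exact: expR_gt0. Qed.

Lemma bump01 a x : 0 <= bump a x <= 1.
Proof.
by apply: prodr_01 => i; rewrite cutoff_ge0 cutoff_le1.
Qed.

Lemma eta01 j x : 0 <= eta j x <= 1.
Proof.
rewrite /eta; case: (pickle_inv j : option J) => [a|]; last by rewrite lexx ler01.
by case: ifP => _; [exact: bump01|rewrite lexx ler01].
Qed.

Lemma flat_algebra_eta j : flat_algebra (eta j).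
Proof.
rewrite /eta; case: (pickle_inv j : option J) => [a|]; last exact: flat_algebra_cst.
case: `[< good a >]; last exact: flat_algebra_cst.
suff coE i : flat_algebra (fun x : V =>
    cutoff ((radius a)^-1 * x ord0 i + - (a.2 i)%:~R)).
  exact: (flat_algebra_prod (index_enum 'I_n) xpredT coE).
have aff (c e : R) f : flat_algebra f ->
    flat_algebra (fun x : V => c * f x + e).
  move=> fE; apply: flat_algebraD; last exact: flat_algebra_cst.
  by apply: flat_algebraM => //; exact: flat_algebra_cst.
have stp f : flat_algebra f -> flat_algebra (fun x : V => step (f x)).
  move=> fE; apply: flat_algebraM; first exact: flat_algebra_cst.
  apply: flat_algebra_flat; apply: flat_algebraD; first exact: flat_algebra_cst.
  by apply: flat_algebraM; [exact: flat_algebra_cst|exact: flat_algebra_flat].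
have co : flat_algebra
    (fun x : V => (radius a)^-1 * x ord0 i + - (a.2 i)%:~R).
  by apply: aff; exact: flat_algebra_coord.
apply: flat_algebraM; apply: stp; last exact: aff.
by apply: flat_algebraD => //; exact: flat_algebra_cst.
Qed.

Lemma bump_coord (a : J) (x : V) i :
  (radius a)^-1 * x ord0 i + - (a.2 i)%:~R =
  (radius a)^-1 * (x - center a) ord0 i.
Proof. by rewrite !mxE mulrBr mulKf// gt_eqF// radius_gt0. Qed.

Lemma bump_neq0 a x i : bump a x != 0 ->
  `|(radius a)^-1 * x ord0 i + - (a.2 i)%:~R| <= 2.
Proof. by move=> /prodf_neq0 h; apply: cutoff_neq0; exact: h. Qed.

Lemma bump_supp a x : bump a x != 0 -> enorm (x - center a) <= spread * radius a.
Proof.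
move=> h; apply: (le_trans (enorm_le_sum _)).
rewrite /spread -mulrA mulrCA -[n in n%:R]card_ord -sum1_card natr_sum mulr_suml.
apply: ler_sum => i _; rewrite mul1r.
have := bump_neq0 i h; rewrite bump_coord normrM gtr0_norm ?invr_gt0 ?radius_gt0//.
by rewrite mulrC ler_pdivrMr ?radius_gt0.
Qed.

Lemma bump_lip : exists2 c : R, 0 <= c &
  forall a x y, `|bump a x - bump a y| <= c * (enorm (x - y) / radius a).
Proof.
have [c c0 cL] := @cutoff_lip R.
exists (c * n%:R) => [|a x y]; first by rewrite mulr_ge0.
apply: (le_trans (dist_prod_le1 _ _ _)) => [i|i|].
- by rewrite cutoff_ge0 cutoff_le1.
- by rewrite cutoff_ge0 cutoff_le1.
rewrite -mulrA mulrCA -[n in n%:R]card_ord -sum1_card natr_sum mulr_suml.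
apply: ler_sum => i _; rewrite mul1r; apply: (le_trans (cL _ _)).
rewrite ler_wpM2l//.
have -> : (radius a)^-1 * x ord0 i + - (a.2 i)%:~R -
    ((radius a)^-1 * y ord0 i + - (a.2 i)%:~R) = (radius a)^-1 * (x - y) ord0 i.
  by rewrite !mxE; ring.
rewrite normrM gtr0_norm ?invr_gt0 ?radius_gt0// mulrC.
by rewrite ler_wpM2r ?coord_le_enorm// invr_ge0 ltW ?radius_gt0.
Qed.

Lemma eta_neq0 j x : eta j x != 0 ->
  exists a, [/\ pickle a = j, good a & bump a x != 0].
Proof.
have := @pickle_invK J j; rewrite /eta.
case: (pickle_inv j : option J) => [a|] /= ja; last by rewrite eqxx.
by case: asboolP => [ga|]; [move=> b; exists a|rewrite eqxx].
Qed.

Lemma eta_dist a x : good a -> bump a x != 0 ->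
  4 * radius a <= dist F x <= (top + 2 * spread) * radius a.
Proof.
move=> /andP[g1 g2] /bump_supp bs.
have := dist_lip F0 x (center a); have := dist_lip F0 (center a) x.
rewrite (enormC (center a)) => h1 h2.
have r0 := radius_gt0 a; have := mulr_ge0 spread0 (ltW r0).
rewrite /far in g1 * => h3.
apply/andP; split; nra.
Qed.

Lemma eta_eq1 x : ~ F x -> exists j, eta j x = 1.
Proof.
move=> Fx; have dx := dist_gt0 F0 closedF Fx.
(* The largest mesh with [far * radius <= dist]; rounding the coordinates down then puts [x] on the
   plateau of the bump. *)
pose k := Num.floor (ln (dist F x / far)).
pose a : J := (k, [ffun i => Num.floor ((expR k%:~R)^-1 * x ord0 i)]).
have r0 := radius_gt0 a.
have df0 : 0 < dist F x / far by rewrite divr_gt0.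
have rl : far * radius a <= dist F x.
  rewrite mulrC -ler_pdivlMr// /radius -[leRHS](lnK df0) ler_expR.
  exact: Num.Theory.floor_le.
have ru : dist F x <= top * radius a.
  rewrite /top mulrAC -ler_pdivrMr// /radius -expRD -[leLHS](lnK df0) ler_expR.
  by rewrite addrC; apply: ltW; have := floorD1_gt (ln (dist F x / far)); rewrite intrD.
have b1 : bump a x = 1.
  rewrite /bump big1// => i _; apply: cutoff_eq1.
  rewrite ffunE -/(radius a); set t := _ * _.
  have := Num.Theory.floor_le t; have := floorD1_gt t; rewrite intrD => h1 h2.
  by rewrite ger0_norm; lra.
have /bump_supp bs : bump a x != 0 by rewrite b1 oner_eq0.
exists (pickle a); rewrite /eta pickleK_inv; case: asboolP => // -[].
have := dist_lip F0 x (center a); have := dist_lip F0 (center a) x.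
rewrite (enormC (center a)) => h1 h2.
by rewrite /good; apply/andP; split; nra.
Qed.

(** A window of integers about [t], indexed by an ordinal: it turns bounds on cells into a count. *)
Lemma int_offset (N : nat) (m : int) (t : R) : `|m%:~R - t| <= N%:R - 1 ->
  exists i : 'I_(2 * N).+1, m = Num.floor t + i%:Z - N%:Z.
Proof.
rewrite ler_norml => /andP[h1 h2].
have f1 := Num.Theory.floor_le t; have := floorD1_gt t; rewrite intrD => f2.
set q := Num.floor t in f1 f2 *.
have a1 : 0 <= m - q + N%:Z.
  rewrite -(ler_int R) intrD intrB -pmulrn; lra.
have a2 : m - q + N%:Z < (2 * N).+1%:Z.
  rewrite -(ltr_int R) intrD intrB -!pmulrn -addn1 natrD natrM; lra.
have a3 : (absz (m - q + N%:Z)%R < (2 * N).+1)%N by rewrite -ltz_nat gez0_abs.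
by exists (Ordinal a3); rewrite /= gez0_abs//; ring.
Qed.

Let ratio : R := top + 2 * spread.

Let ratio_ge : 4 <= ratio.
Proof.
rewrite /ratio /top /far; have := spread0; have : (1 : R) <= expR 1.
  by rewrite -[leLHS]expR0 ler_expR.
move=> e1 s0; nra.
Qed.

(** The point is that [N] does not depend on [x]. A cell active near [x] has radius comparable to
    [dist F x], so its scale is within a constant of [ln (dist F x)] and its grid coordinates are
    within a constant of those of [x] in units of the radius. *)
Lemma active_finite : exists N : nat, forall x, ~ F x -> exists s : seq nat,
  [/\ uniq s, (size s <= N)%N & forall y j, enorm (x - y) < dist F x / 2 ->
     eta j y != 0 -> j \in s].
Proof.
(* Bounds the deviations of the grid coordinates and of the scale, with the margin 1 asked by
   [int_offset]. *)
have [N1 [N1a N1b]] : exists N : nat, ratio + 3 <= N%:R /\ ln (2 * ratio) + 1 <= N%:R.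
  exists (Num.truncn (ratio + 3 + `|ln (2 * ratio) + 1|)).+1.
  have h := truncnS_gt (ratio + 3 + `|ln (2 * ratio) + 1|).
  have := ler_norm (ln (2 * ratio) + 1); have := normr_ge0 (ln (2 * ratio) + 1).
  by have := ratio_ge; move: h; split; lra.
pose M := (2 * N1).+1; pose I := ('I_M * {ffun 'I_n -> 'I_M})%type.
exists #|{: I}| => x Fx; set dx := dist F x.
have dx0 : 0 < dx := dist_gt0 F0 closedF Fx.
pose cell (ab : I) : J :=
  let k := Num.floor (ln dx) + ab.1%:Z - N1%:Z in
  (k, [ffun l => Num.floor ((expR (k%:~R : R))^-1 * x ord0 l) + (ab.2 l)%:Z - N1%:Z]).
exists (undup [seq pickle (cell ab) | ab <- enum {: I}]); split.
- exact: undup_uniq.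
- by apply: (leq_trans (size_undup _)); rewrite size_map -cardE.
move=> y j xy /eta_neq0[a [ja ga ba]].
have /andP[r1 r2] := eta_dist ga ba.
have r0 := radius_gt0 a.
have y1 := dist_lip F0 x y; have y2 := dist_lip F0 y x.
rewrite (enormC y) -/dx in y2; rewrite -/dx in y1.
have rl : radius a <= dx by lra.
have ru : dx <= 2 * ratio * radius a by rewrite -mulrA /ratio; lra.
have ratio0 : 0 < 2 * ratio by have := ratio_ge; lra.
have [i Ei] : exists i : 'I_M, a.1 = Num.floor (ln dx) + i%:Z - N1%:Z.
  apply: int_offset; rewrite ler_norml; apply/andP; split.
    have : ln dx <= ln (2 * ratio) + a.1%:~R.
      rewrite -[a.1%:~R]expRK -lnM ?posrE ?expR_gt0// ler_ln ?posrE//.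
      exact: lt_le_trans dx0 ru.
    by lra.
  have : a.1%:~R <= ln dx by rewrite -ler_expR lnK.
  by have := ratio_ge; lra.
have hb l : exists b : 'I_M,
    a.2 l = Num.floor ((radius a)^-1 * x ord0 l) + b%:Z - N1%:Z.
  apply: int_offset.
  have := bump_neq0 l ba.
  have -> : (a.2 l)%:~R - (radius a)^-1 * x ord0 l =
      - ((radius a)^-1 * y ord0 l + - (a.2 l)%:~R) -
      (radius a)^-1 * (x - y) ord0 l by rewrite !mxE; ring.
  have c1 := coord_le_enorm (x - y) l.
  have c2 : `|(radius a)^-1 * (x - y) ord0 l| <= ratio.
    rewrite normrM gtr0_norm ?invr_gt0// mulrC ler_pdivrMr//.
    rewrite -mulrA in ru; lra.
  move=> c3; apply: (le_trans (ler_normB _ _)); rewrite normrN.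
  by lra.
have [b Eb] := choice hb.
rewrite mem_undup; apply/mapP; exists (i, finfun b); first by rewrite mem_enum.
rewrite -ja; congr pickle; rewrite /cell /= -Ei [LHS]surjective_pairing.
by congr pair; apply/ffunP => l; rewrite !ffunE Eb.
Qed.

Theorem exists_whitney : exists w p d delta C, @whitney R n F w p d delta C.
Proof.
have [c c0 cL] := bump_lip; have [N HN] := active_finite.
pose K := c * (2 * ratio).
have s0 := spread0; have t0 := top_gt0; have ra := ratio_ge.
have N0 : 0 <= N%:R :> R by [].
have K0 : 0 <= K by rewrite mulr_ge0//; lra.
have NK0 : 0 <= N%:R * K by rewrite mulr_ge0.
(* One constant for all fields: 2 for the sizes and the radius [dist F x / C],
   [spread + 2 * (top + spread)] for the way from the support to [p j] through the center, [N] for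
   the number of active indices, [N * K] for the Lipschitz constant of the weights. *)
pose C := 2 + spread + 2 * (top + spread) + N%:R + N%:R * K.
have C2 : 2 <= C by rewrite /C; lra.
pose cell (j : nat) : J := odflt (0, [ffun=> 0]) (pickle_inv j : option J).
(* A cell whose center is at distance 0 is not good, so its point may be arbitrary. *)
have /choice[p Hp] : forall j, exists q, F q /\
    (0 < dist F (center (cell j)) ->
     enorm (center (cell j) - q) <= 2 * dist F (center (cell j))).
  move=> j; have [h|h] := ltP 0 (dist F (center (cell j))).
    by have [q Fq hq] := near_point F0 h; exists q.
  by have [q Fq] := F0; exists q.
pose w := seq_weight eta.
have cellE j x : eta j x != 0 ->
    good (cell j) /\ forall z, eta j z = bump (cell j) z.
  move=> /eta_neq0[a [ja ga ba]]; rewrite /eta /cell -ja pickleK_inv /=.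
  by split=> // z; case: asboolP.
have active j x : eta j x != 0 -> good (cell j) /\ bump (cell j) x != 0.
  by move=> ex; have [gj <-] := cellE j x ex.
have w_active j x : w j x != 0 -> eta j x != 0.
  by apply: contra_neq; exact: seq_weight_eq0.
exists w, p, (fun j => radius (cell j)), (dist F), C; split.
- by lra.
- by move=> j; have [] := Hp j.
- by move=> j; exact: radius_gt0.
- move=> j; apply: flat_algebraM; first exact: flat_algebra_eta.
  suff H i : flat_algebra (fun x : V => 1 - eta i x).
    exact: (flat_algebra_prod (iota 0 j) xpredT H).
  apply: flat_algebraD; first exact: flat_algebra_cst.
  under eq_fun do rewrite -mulN1r.
  by apply: flat_algebraM; [exact: flat_algebra_cst|exact: flat_algebra_eta].
- by move=> j x; apply: seq_weight_ge0; exact: eta01.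
- by move=> x Fx; exact: dist_gt0.
- by move=> x q Fq; exact: dist_le.
- move=> x j Fx /w_active/active[ga ba].
  have /andP[g1 g2] := ga; have bs := bump_supp ba.
  have /andP[d1 d2] := eta_dist ga ba.
  have r0 := radius_gt0 (cell j).
  have dx0 := dist_gt0 F0 closedF Fx.
  have dc0 : 0 < dist F (center (cell j)).
    apply: (lt_le_trans _ g1); rewrite mulr_gt0// /far; lra.
  have pc := (Hp j).2 dc0.
  have tri := enorm_tri (center (cell j)) x (p j).
  split.
    have h : (spread + 2 * (top + spread)) * radius (cell j) <= C * radius (cell j).
      by rewrite ler_wpM2r ?ltW// /C; lra.
    by apply: le_trans h; lra.
  have h : 2 * dist F x <= C * dist F x by rewrite ler_wpM2r// ltW.
  by lra.
move=> x Fx; have [s [us sN sA]] := HN x Fx; exists s.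
have dx0 := dist_gt0 F0 closedF Fx.
split=> //.
  have : (size s)%:R <= N%:R :> R by rewrite ler_nat.
  by rewrite /C => ?; lra.
have closeH z : enorm (x - z) < dist F x / C -> enorm (x - z) < dist F x / 2.
  move=> h; apply: (lt_le_trans h); rewrite ler_pM2l// lef_pV2 ?posrE//; lra.
move=> y xy.
have xy2 := closeH _ xy.
have y1 := dist_lip F0 x y; have y2 := dist_lip F0 y x; rewrite (enormC y) in y2.
have xx : enorm (x - x) < dist F x / 2 by rewrite subrr enorm0 divr_gt0.
have outs z j : enorm (x - z) < dist F x / 2 -> j \notin s -> eta j z = 0.
  by move=> xz js; apply/eqP; apply: contraNT js; exact: sA.
have Fy : ~ F y.
  move=> Fy; have := dist_le F0 y Fy; rewrite subrr enorm0; lra.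
split=> //.
- apply: seq_weight_sum1 => //.
  + by move=> j js; exact: (outs y).
  + exact: eta_eq1.
- by move=> j js; rewrite /w seq_weight_eq0// (outs y).
move=> j; set e := enorm (x - y).
have e0 : 0 <= e / dist F x by rewrite divr_ge0 ?enorm_ge0// ltW.
apply: (@le_trans _ _ ((size s)%:R * (K * (e / dist F x)))).
  apply: seq_weight_lip => //; first exact: eta01.
  - by rewrite mulr_ge0.
  - by move=> i is_; split; [exact: (outs x)|exact: (outs y)].
  move=> i.
  (* One active point [z] bounds the radius from below by a multiple of [dist F x]. Either [x] or
     [y] serves; if neither is active, the difference is zero. *)
  have bound z : eta i z != 0 -> dist F x <= 2 * dist F z ->
      `|eta i x - eta i y| <= K * (e / dist F x).
    move=> ez xz; have [gi Ei] := cellE i z ez.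
    have /andP[_ dz] : 4 * radius (cell i) <= dist F z <=
        (top + 2 * spread) * radius (cell i).
      by apply: eta_dist => //; rewrite -Ei.
    rewrite !Ei; apply: (le_trans (cL _ _ _)); rewrite -/e /K -!mulrA ler_wpM2l//.
    rewrite ler_pdivrMr ?radius_gt0//.
    have -> : 2 * (ratio * (e / dist F x)) * radius (cell i) =
        e * ((2 * (ratio * radius (cell i))) / dist F x) by ring.
    rewrite ler_peMr ?enorm_ge0// ler_pdivlMr// mul1r.
    by apply: (le_trans xz); rewrite ler_wpM2l.
  have [ex|ex] := eqVneq (eta i x) 0; last by apply: (bound x) => //; lra.
  have [ey|ey] := eqVneq (eta i y) 0; last by apply: (bound y) => //; lra.
  by rewrite ex ey subrr normr0 mulr_ge0.
rewrite mulrA ler_wpM2r//.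
have : (size s)%:R * K <= N%:R * K by rewrite ler_wpM2r// ler_nat.
by rewrite /C; lra.
Qed.

End WhitneyConstruction.

(** * Selection of the operators *)

Section Selection.
Context {R : realType} {n : nat} {Y : normedModType R}.
Local Notation V := 'rV[R]_n.

Definition op_le (T : V -> Y) (c : R) : Prop := forall v, `|T v| <= c * enorm v.

Lemma op_leW (T : V -> Y) (b c : R) : b <= c -> op_le T b -> op_le T c.
Proof. by move=> bc Tb v; apply: (le_trans (Tb v)); rewrite ler_wpM2r ?enorm_ge0. Qed.

Lemma op_le_sub (S T : V -> Y) (b c : R) : op_le S b -> op_le T c ->
  op_le (fun v => S v - T v) (b + c).
Proof.
by move=> Sb Tc v; rewrite mulrDl (le_trans (ler_normB _ _))// lerD.
Qed.

Lemma op_le_tri (S T U : V -> Y) (b c : R) :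
  op_le (fun v => S v - T v) b -> op_le (fun v => T v - U v) c ->
  op_le (fun v => S v - U v) (b + c).
Proof.
move=> Sb Tc v; rewrite -(subrK (T v) (S v)) -addrA mulrDl.
by apply: (le_trans (ler_normD _ _)); apply: lerD.
Qed.

Lemma op_leC (S T : V -> Y) (b : R) :
  op_le (fun v => S v - T v) b -> op_le (fun v => T v - S v) b.
Proof. by move=> h v; rewrite distrC. Qed.

Variables (F : set V) (L : V -> {linear V -> Y}).
Variable Lk : nat -> V -> {linear V -> Y}.
Hypothesis Lk_cont : forall k a, F a -> forall eps : R, 0 < eps ->
  exists2 d : R, 0 < d & forall x, F x -> enorm (x - a) < d ->
    op_le (fun v => Lk k x v - Lk k a v) eps.
Hypothesis Lk_lim : forall x, F x -> forall eps : R, 0 < eps ->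
  exists N : nat, forall k, (N <= k)%N -> op_le (fun v => Lk k x v - L x v) eps.

(* [L q], with [q] close to [p], approximates on the whole ball of radius
   [k.+1 * s ^+ 4] around [p] an operator field of the approximating sequence. *)
Definition fits (p : V) (s : R) (k : nat) (q : V) : Prop :=
  [/\ F q, enorm (q - p) <= s ^+ 2, op_le (L q) (Num.sqrt k.+1%:R) &
   exists2 i, (k <= i)%N & forall z, F z -> enorm (z - p) <= k.+1%:R * s ^+ 4 ->
     op_le (fun v => Lk i z v - L q v) k.+1%:R^-1].

(** A cap that makes a maximal level exist; any fixed level passes it once [s] is small. *)
Definition admissible (s : R) (k : nat) : Prop := k%:R <= s^-1.

(** If no level fits, a value of [L] of almost minimal norm within [s ^+ 2] of [p] is taken, or 0 if
    even that norm is beyond about [s^-1]. [N] is a natural number so that a least one exists; [+ 1]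
    is the cost of rounding. *)
Variant selected (p : V) (s : R) (T : {linear V -> Y}) : Prop :=
| SelFits k q of admissible s k & fits p s k q &
    (forall k' q', admissible s k' -> fits p s k' q' -> (k' <= k)%N) & T = L q
| SelSmall q (N : nat) of (forall k' q', admissible s k' -> ~ fits p s k' q') &
    F q & enorm (q - p) <= s ^+ 2 & op_le (L q) N%:R &
    (forall q' c, F q' -> enorm (q' - p) <= s ^+ 2 -> 0 <= c ->
       op_le (L q') c -> N%:R <= c + 1) &
    (N%:R <= s^-1 + 1 /\ T = L q) \/ (s^-1 + 1 < N%:R /\ T = \0).

Lemma exists_selected p s : F p -> 0 < s -> exists T, selected p s T.
Proof.
move=> Fp s0.
have [[k0 [q0 [a0 f0]]]|nf] := pselect (exists k q, admissible s k /\ fits p s k q).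
  pose P k := `[< admissible s k /\ exists q, fits p s k q >].
  have Pex : exists k, P k by exists k0; apply/asboolP; split=> //; exists q0.
  have Pub k : P k -> (k <= Num.truncn (s^-1))%N.
    move=> /asboolP[ak _]; rewrite -ltnS -(ltr_nat R).
    exact: le_lt_trans ak (truncnS_gt _).
  case: (ex_maxnP Pex Pub) => k /asboolP[ak [q fq]] kmax.
  exists (L q); apply: (SelFits ak fq) => // k' q' ak' fq'.
  by apply: kmax; apply/asboolP; split=> //; exists q'.
pose P N := `[< exists q, [/\ F q, enorm (q - p) <= s ^+ 2 & op_le (L q) N%:R] >].
have Pge q c : F q -> enorm (q - p) <= s ^+ 2 -> op_le (L q) c ->
    P (Num.truncn c).+1.
  move=> Fq qp Lc; apply/asboolP; exists q; split=> //.
  by apply: op_leW Lc; apply: ltW; exact: truncnS_gt.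
have Pex : exists N, P N.
  have [c _ Lc] := linear_bounded (L p).
  exists (Num.truncn c).+1; apply: (Pge p) => //.
  by rewrite subrr enorm0 exprn_ge0// ltW.
case: (ex_minnP Pex) => N /asboolP[q [Fq qp LqN]] Nmin.
have Nle q' c : F q' -> enorm (q' - p) <= s ^+ 2 -> 0 <= c ->
    op_le (L q') c -> N%:R <= c + 1.
  move=> Fq' qp' c0 Lc; have := Nmin _ (Pge _ _ Fq' qp' Lc).
  rewrite -(ler_nat R) => /le_trans; apply.
  by rewrite -addn1 natrD lerD2r truncn_le.
have nf' k' q' : admissible s k' -> ~ fits p s k' q'.
  by move=> ak fk; apply: nf; exists k', q'.
have [h|h] := leP (N%:R : R) (s^-1 + 1).
  by exists (L q); apply: (SelSmall nf' Fq qp LqN Nle); left.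
by exists \0; apply: (SelSmall nf' Fq qp LqN Nle); right.
Qed.

(** Some member of the sequence of index at least [K] is close to [L a] at [a], and by its
    continuity at [a] it remains so on every small ball near [a]. *)
Lemma fits_near a (K : nat) (c : R) : F a -> op_le (L a) c -> c ^+ 2 <= K.+1%:R ->
  exists2 sigma : R, 0 < sigma & forall p s, 0 < s < sigma ->
    enorm (p - a) <= K.+1%:R * s ^+ 4 -> admissible s K /\ fits p s K a.
Proof.
move=> Fa Lac cK; set k : R := K.+1%:R.
have k0 : 0 < k by rewrite ltr0n.
have k1 : 1 <= k by rewrite ler1n.
have e0 : 0 < k^-1 / 2 by rewrite divr_gt0// invr_gt0.
have [N HN] := Lk_lim Fa e0.
pose i := maxn K N.
have [d d0 Hd] := Lk_cont i Fa e0.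
(* The first bound gives [k * s <= 1], hence [k * s ^+ 4 <= s ^+ 2]; the second puts the ball around
   [p] inside the ball of continuity around [a]. *)
exists (Num.min (k^-1) (d / (2 * k))).
  by rewrite lt_min invr_gt0 k0/= divr_gt0// mulr_gt0.
move=> p s /andP[s0]; rewrite lt_min => /andP[sk sd] pa.
have ks : k * s <= 1 by rewrite mulrC -ler_pdivlMr// mul1r ltW.
have s1 : s <= 1.
  by apply: le_trans ks; rewrite ler_peMl// ltW.
have s21 : s ^+ 2 <= 1 by rewrite expr_le1// ltW.
have s20 : 0 < s ^+ 2 by rewrite exprn_gt0.
have ks4 : k * s ^+ 4 <= s ^+ 2.
  have -> : k * s ^+ 4 = (k * s) * s * s ^+ 2 by ring.
  by rewrite ler_piMl ?(ltW s20)// mulr_ile1// ltW// mulr_gt0.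
have ks4s : k * s ^+ 4 <= k * s.
  by rewrite ler_pM2l// exprS ler_piMr ?(ltW s0)// exprn_ile1 // ltW.
have sd' : 2 * (k * s) < d.
  by move: sd; rewrite ltr_pdivlMr ?mulr_gt0//; lra.
split.
  rewrite /admissible -[s^-1]mul1r ler_pdivlMr//; apply: le_trans ks.
  by rewrite ler_wpM2r ?(ltW s0)// ler_nat.
split => //.
- by rewrite enormC; apply: le_trans ks4.
- apply: op_leW Lac; apply: (le_trans (ler_norm c)).
  by rewrite -sqrtr_sqr ler_wsqrtr.
exists i => [|z Fz]; rewrite ?leq_maxl// -/k => zp.
have za : enorm (z - a) < d.
  apply: (le_lt_trans (enorm_tri p _ _)); lra.
apply: op_leW (op_le_tri (Hd z Fz za) (HN i (leq_maxr _ _))).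
by rewrite -/k -splitr.
Qed.

Lemma selected_close a (eps : R) : F a -> 0 < eps ->
  exists2 sigma : R, 0 < sigma & forall p s T, F p -> 0 < s < sigma ->
    selected p s T -> forall v,
    `|T v - L a v| * s ^+ 4 <= eps * (enorm (p - a) + s ^+ 4) * enorm v.
Proof.
move=> Fa eps0; have [A A0 LaA] := linear_bounded (L a).
have e20 : 0 < eps / 2 by rewrite divr_gt0.
have [N HN] := Lk_lim Fa e20.
(* Each term secures one demand on [K]: the index of convergence, the candidacy of [a],
   [K.+1^-1 <= eps / 2], the case of a bounded level below, and the absorption of [2 * A + 1]. *)
pose b := N%:R + A ^+ 2 + 2 / eps + (2 / eps) ^+ 2 + (2 * A + 1) / eps.
pose K := Num.truncn b.
have ie0 : 0 < 2 / eps by rewrite divr_gt0.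
have A20 := sqr_ge0 A; have ie20 := sqr_ge0 (2 / eps).
have N0 : 0 <= N%:R :> R by [].
have Ae0 : 0 <= (2 * A + 1) / eps by rewrite divr_ge0 ?ltW//; lra.
have bK : b < K.+1%:R := truncnS_gt b.
have NK : N%:R < K.+1%:R :> R by apply: (le_lt_trans _ bK); rewrite /b; lra.
have AK : A ^+ 2 <= K.+1%:R by apply: ltW; apply: (le_lt_trans _ bK); rewrite /b; lra.
have eK : 2 / eps <= K.+1%:R by apply: ltW; apply: (le_lt_trans _ bK); rewrite /b; lra.
have e2K : (2 / eps) ^+ 2 <= K.+1%:R by apply: ltW; apply: (le_lt_trans _ bK); rewrite /b; lra.
have AeK : 2 * A + 1 <= eps * K.+1%:R.
  rewrite [eps * _]mulrC -ler_pdivrMr//; apply: ltW; apply: (le_lt_trans _ bK); rewrite /b; lra.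
have [sigma sigma0 Hs] := fits_near Fa LaA AK.
exists (Num.min sigma (Num.min 1 (eps / (2 + A)))).
  by rewrite !lt_min sigma0 ltr01 divr_gt0//; lra.
move=> p s T Fp /andP[s0]; rewrite !lt_min => /andP[ss /andP[s1 se]] sel.
set D := enorm (p - a); have D0 : 0 <= D by exact: enorm_ge0.
have d0 : 0 < s ^+ 4 by rewrite exprn_gt0.
set d := s ^+ 4 in d0 *.
have near_fits : D <= K.+1%:R * d -> admissible s K /\ fits p s K a.
  by apply: Hs; rewrite s0 ss.
suff [c cT cD] : exists2 c, op_le (fun v => T v - L a v) c & c * d <= eps * (D + d).
  move=> v; apply: (@le_trans _ _ (c * enorm v * d)).
    by rewrite ler_wpM2r// ltW.
  by rewrite mulrAC ler_wpM2r ?enorm_ge0.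
case: sel => [k q ak [Fq qp Lq [i ki Hi]] kmax ->|q M nf Fq qp LqM Mmin TE].
(* If [a] lies in the ball of the selected level, maximality against the candidate [a] forces
   [K <= k], and the approximant [Lk i a] links [L q] to [L a]. *)
- have [Dk|Dk] := leP D (k.+1%:R * d).
  + have kK : (K <= k)%N.
      rewrite leqNgt; apply/negP => kK.
      have [aK fK] : admissible s K /\ fits p s K a.
        apply: near_fits; apply: (le_trans Dk); rewrite ler_wpM2r ?(ltW d0)//.
        by rewrite ler_nat ltnS ltnW.
      by have := kmax _ _ aK fK; rewrite leqNgt kK.
    exists (k.+1%:R^-1 + eps / 2).
      apply: (op_le_tri (T := Lk i a)).
        by apply: op_leC; apply: Hi => //; rewrite enormC.
      apply: HN; apply: leq_trans ki; apply: leq_trans kK.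
      by move: NK; rewrite ltr_nat ltnS.
    have kinv : k.+1%:R^-1 <= eps / 2.
      rewrite -[eps / 2]invrK lef_pV2 ?posrE ?invr_gt0// invf_div.
      by apply: (le_trans eK); rewrite ler_nat ltnS.
    apply: ler_pM => //; first by rewrite addr_ge0// ltW.
    - exact: ltW.
    - by rewrite [leRHS]splitr lerD2r.
    - by rewrite lerDr.
  (* Outside that ball [L q] and [L a] are not compared; each norm times [d] is small against
     [D]. *)
  + have DK : K.+1%:R * d < D.
      rewrite ltNge; apply/negP => DK; have [aK fK] := near_fits DK.
      have := lt_le_trans Dk DK; rewrite ltr_pM2r// ltr_nat ltnS => kK.
      by have := kmax _ _ aK fK; rewrite leqNgt kK.
    exists (Num.sqrt k.+1%:R + A); first exact: op_le_sub.
    set x := Num.sqrt _; have x0 : 0 <= x by exact: sqrtr_ge0.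
    have x2 : x * x = k.+1%:R by rewrite -expr2 sqr_sqrtr.
    (* [x = x^2 / x] when [x] is large, and [x] is bounded by a constant
       otherwise. *)
    have xd : x * d <= eps / 2 * D.
      have [xe|xe] := leP (2 / eps) x.
        have : x * d <= eps / 2 * (x * x * d).
          have -> : eps / 2 * (x * x * d) = (eps / 2 * x) * (x * d) by ring.
          apply: ler_peMl; first by apply: mulr_ge0 => //; exact: ltW.
          by move: xe; rewrite ler_pdivrMr// => xe; lra.
        have : eps / 2 * (x * x * d) <= eps / 2 * D.
          by rewrite ler_wpM2l ?(ltW e20)// x2 ltW.
        by lra.
      apply: (@le_trans _ _ (eps / 2 * (K.+1%:R * d))); last first.
        by rewrite ler_wpM2l ?(ltW e20)// ltW.
      apply: (@le_trans _ _ (eps / 2 * ((2 / eps) ^+ 2 * d))); last first.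
        by rewrite ler_wpM2l ?(ltW e20)// ler_wpM2r ?(ltW d0).
      have -> : eps / 2 * ((2 / eps) ^+ 2 * d) = (2 / eps) * d.
        by field; rewrite gt_eqF.
      by apply: ler_wpM2r; exact: ltW.
    have : (2 * A + 1) * d <= eps * K.+1%:R * d by rewrite ler_wpM2r ?(ltW d0).
    have : eps * (K.+1%:R * d) <= eps * D by rewrite ler_wpM2l ?(ltW eps0)// ltW.
    have := mulr_ge0 (ltW eps0) (ltW d0).
    by lra.
- have DK : K.+1%:R * d < D.
    by rewrite ltNge; apply/negP => /near_fits[aK fK]; exact: nf aK fK.
  have [ap|ap] := leP (enorm (a - p)) (s ^+ 2).
  + have MA := Mmin a A Fa ap A0 LaA.
    exists (A + 1 + A).
      apply: op_le_sub => //; case: TE => -[_ ->].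
        exact: op_leW LqM.
      by move=> v; rewrite /= normr0 mulr_ge0 ?enorm_ge0//; lra.
    have : (2 * A + 1) * d <= eps * K.+1%:R * d by rewrite ler_wpM2r ?(ltW d0).
    have : eps * (K.+1%:R * d) <= eps * (D + d) by rewrite ler_wpM2l ?(ltW eps0)//; lra.
    by lra.
  exists (s^-1 + 1 + A).
    apply: op_le_sub => //; case: TE => -[h ->]; first exact: op_leW LqM.
    by move=> v; rewrite /= normr0 mulr_ge0 ?enorm_ge0// ltW// addr_gt0 ?invr_gt0.
  have : (s^-1 + 1 + A) * d <= eps * s ^+ 2.
    have -> : (s^-1 + 1 + A) * d = (s + s * s * (1 + A)) * s ^+ 2.
      by rewrite /d; field; rewrite gt_eqF.
    rewrite ler_wpM2r ?sqr_ge0//.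
    move: se; rewrite ltr_pdivlMr; last lra.
    have : s * (s * (1 + A)) <= 1 * (s * (1 + A)).
      by rewrite ler_wpM2r ?(ltW s1)// mulr_ge0 ?(ltW s0)//; lra.
    by lra.
  have : eps * s ^+ 2 <= eps * (D + d).
    by rewrite ler_wpM2l ?(ltW eps0)// /D enormC; lra.
  by lra.
Qed.

End Selection.

(** * Local estimates *)

Section Reformulations.
Context {R : realType} {n : nat} {Y : normedModType R}.
Local Notation V := 'rV[R]_n.
Implicit Types (A : set V) (g : V -> Y) (a : V) (T : {linear V -> Y}).

(** Clearing the denominator absorbs the isolated case together with [x = a]. *)
Lemma frechet_bound A g a T : frechet_at A g a T -> forall eps : R, 0 < eps ->
  exists2 r : R, 0 < r & forall x, A x -> enorm (x - a) < r ->
    `|g x - g a - T (x - a)| <= eps * enorm (x - a).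
Proof.
have triv x eps : x = a -> `|g x - g a - T (x - a)| <= eps * enorm (x - a).
  by move=> ->; rewrite !subrr linear0 subrr normr0 enorm0 mulr0.
move=> [[r r0 iso] eps eps0|h eps eps0].
  by exists r => // x Ax xr; apply: triv; exact: iso.
have [r r0 hr] := h eps eps0; exists r => // x Ax xr.
have [->|xa] := eqVneq x a; first exact: triv.
have x0 := enorm_gt0 xa.
by rewrite -ler_pdivrMr// ltW// hr// x0.
Qed.

Lemma bound_frechet g a T : (forall eps : R, 0 < eps ->
  exists2 r : R, 0 < r & forall x, enorm (x - a) < r ->
    `|g x - g a - T (x - a)| <= eps * enorm (x - a)) -> frechet_at setT g a T.
Proof.
move=> h; right=> eps eps0; have e0 : 0 < eps / 2 by rewrite divr_gt0.
have [r r0 hr] := h _ e0; exists r => // x _ /andP[x0 xr].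
by rewrite ltr_pdivrMr//; apply: (le_lt_trans (hr x xr)); rewrite ltr_pM2r//; lra.
Qed.

Lemma strict_bound A g a T : strict_at A g a T -> forall eps : R, 0 < eps ->
  exists2 r : R, 0 < r & forall x y, A x -> A y -> enorm (x - a) < r ->
    enorm (y - a) < r -> `|g x - g y - T (x - y)| <= eps * enorm (x - y).
Proof.
have triv x y eps : x = y -> `|g x - g y - T (x - y)| <= eps * enorm (x - y).
  by move=> ->; rewrite !subrr linear0 subrr normr0 enorm0 mulr0.
move=> [[r r0 iso] eps eps0|h eps eps0].
  exists r => // x y Ax Ay xr yr; apply: triv.
  by rewrite (iso x)// (iso y).
have [r r0 hr] := h eps eps0; exists r => // x y Ax Ay xr yr.
have [->|xy] := eqVneq x y; first exact: triv.
have x0 := enorm_gt0 xy.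
by rewrite -ler_pdivrMr// ltW// hr// eq_sym.
Qed.

Lemma bound_strict g a T : (forall eps : R, 0 < eps ->
  exists2 r : R, 0 < r & forall x y, enorm (x - a) < r -> enorm (y - a) < r ->
    `|g x - g y - T (x - y)| <= eps * enorm (x - y)) -> strict_at setT g a T.
Proof.
move=> h; right=> eps eps0; have e0 : 0 < eps / 2 by rewrite divr_gt0.
have [r r0 hr] := h _ e0; exists r => // x y _ _ xy xr yr.
have x0 : 0 < enorm (y - x) by apply: enorm_gt0; rewrite eq_sym.
by rewrite ltr_pdivrMr//; apply: (le_lt_trans (hr y x yr xr)); rewrite ltr_pM2r//; lra.
Qed.

Lemma holder_bound A g a (alpha : R) : holder_at A g a alpha ->
  exists2 K : R, 0 <= K & exists2 r : R, 0 < r & forall x, A x ->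
    enorm (x - a) < r -> `|g x - g a| <= K * enorm (x - a) `^ alpha.
Proof.
move=> [[r r0 iso]|[K [r r0 h]]].
  exists 0 => //; exists r => // x Ax xr.
  by rewrite (iso x)// subrr normr0 mul0r.
exists `|K| => //; exists r => // x Ax xr.
have [->|xa] := eqVneq x a.
  by rewrite subrr normr0 mulr_ge0 ?powR_ge0.
have x0 := enorm_gt0 xa.
rewrite -ler_pdivrMr ?powR_gt0//; apply: le_trans (ler_norm K).
by rewrite h// x0.
Qed.

Lemma differentiable_enorm g a : differentiable g a -> forall eps : R, 0 < eps ->
  exists2 r : R, 0 < r & forall x, enorm (x - a) < r ->
    `|g x - g a - 'd g a (x - a)| <= eps * enorm (x - a).
Proof.
move=> /diff_locallyP[_ /eqaddoP h] eps eps0.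
have /nbhs_ballP[r /= r0 hr] := h eps eps0.
exists r => // x xr.
have := hr (x - a); rewrite -ball_normE /= sub0r normrN => /(_ _).
have -> : (g \o shift a - (cst (g a) + 'd g a)) (x - a) =
    g x - g a - 'd g a (x - a).
  by rewrite !fctE /= subrK opprD addrA.
move=> /(_ (le_lt_trans (norm_le_enorm _) xr)) /le_trans; apply.
by rewrite ler_wpM2l ?(ltW eps0)// norm_le_enorm.
Qed.

(** Both bounds are tested on [t *: v] with [t] small. This converts a strict estimate around [a]
    into closeness of the nearby derivatives to [L a]. *)
Lemma linear_le_of_lip (T : {linear V -> Y}) (b : R) g x (D : {linear V -> Y}) (rho : R) :
  0 < rho -> 0 <= b ->
  (forall y, enorm (y - x) < rho ->
     `|g y - g x - T (y - x)| <= b * enorm (y - x)) ->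
  (forall eps : R, 0 < eps -> exists2 r : R, 0 < r & forall y, enorm (y - x) < r ->
    `|g y - g x - D (y - x)| <= eps * enorm (y - x)) ->
  op_le (fun v => D v - T v) b.
Proof.
move=> rho0 b0 gT gD v.
have [->|v0] := eqVneq v 0; first by rewrite (linear0 D) (linear0 T) subr0 normr0 enorm0 mulr0.
have ev : 0 < enorm v by have := enorm_gt0 v0; rewrite subr0.
apply/ler_addgt0Pr => e e0.
have [r r0 gr] := gD (e / enorm v) (divr_gt0 e0 ev).
pose t := Num.min r rho / (2 * enorm v).
have m0 : 0 < Num.min r rho by rewrite lt_min r0.
have t0 : 0 < t by rewrite divr_gt0// mulr_gt0.
have tv : enorm ((t *: v + x) - x) < Num.min r rho.
  rewrite addrK enormZ gtr0_norm// /t invfM mulrA mulfVK ?gt_eqF//.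
  by rewrite gtr_pMr// invf_lt1// ltr1n.
have [tr trho] : enorm ((t *: v + x) - x) < r /\ enorm ((t *: v + x) - x) < rho.
  by move: tv; rewrite lt_min => /andP.
have h1 := gr _ tr; have h2 := gT _ trho; rewrite addrK enormZ gtr0_norm// in h1 h2.
rewrite -(ler_pM2l t0) -{1}(gtr0_norm t0) -normrZ scalerBr -!linearZ /=.
set c := g _ - g x in h1 h2.
have -> : D (t *: v) - T (t *: v) = (c - T (t *: v)) - (c - D (t *: v)).
  by rewrite opprB [RHS]addrC subrKA.
apply: (le_trans (ler_normB _ _)).
have e1 : e / enorm v * (t * enorm v) = t * e by field; rewrite gt_eqF.
by rewrite e1 in h1; lra.
Qed.

End Reformulations.

(** * From local to uniform Lipschitz bounds on compact balls *)

Section LocallyLipschitz.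
Context {R : realType} {n : nat} {Y : normedModType R}.
Local Notation V := 'rV[R]_n.

Definition lip_near (g : V -> Y) (b : V) : Prop := exists2 rho : R, 0 < rho &
  exists2 K : R, 0 <= K & forall x y, enorm (x - b) < rho -> enorm (y - b) < rho ->
    `|g x - g y| <= K * enorm (x - y).

Lemma nbhs_enorm (x : V) (r : R) : 0 < r -> \forall y \near x, enorm (y - x) < r.
Proof.
move=> r0; have n0 : 0 < n%:R + 1 :> R by rewrite ltr_wpDl.
apply/nbhs_ballP; exists (r / (n%:R + 1)); first by rewrite /= divr_gt0.
move=> y; rewrite -ball_normE /= ltr_pdivlMr// => xy; rewrite enormC.
apply: (le_lt_trans (enorm_le_norm _)); apply: le_lt_trans xy.
by rewrite mulrC ler_wpM2l// lerDl.
Qed.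

Lemma compact_enorm_ball (a : V) (r : R) : compact [set x | enorm (x - a) <= r].
Proof.
apply: bounded_closed_compact.
  exists (r + `|a|); split; first exact: num_real.
  move=> M rM x /= xr; apply: ltW; apply: le_lt_trans rM.
  rewrite -[x](subrK a); apply: (le_trans (ler_normD _ _)); rewrite lerD2r.
  exact: le_trans (norm_le_enorm _) xr.
rewrite -[X in closed X]setCK; apply: open_closedC.
rewrite openE => x /= /negP; rewrite -ltNge => xr.
have e0 : 0 < enorm (x - a) - r by rewrite subr_gt0.
apply: filterS (nbhs_enorm x e0) => y xy /=; apply/negP; rewrite -ltNge.
by have := enorm_tri y x a; rewrite (enormC x y); lra.
Qed.

(** Off the diagonal [|x - y|] stays above a third of [|b - c|] while the values stay bounded.
    Quantifying over all [K' > K] suits the filter of neighbourhoods of infinity. *)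
Lemma lip_near_pair (g : V -> Y) (b c : V) : lip_near g b -> lip_near g c ->
  exists2 rho : R, 0 < rho & exists K : R, forall x y K', K < K' ->
    enorm (x - b) < rho -> enorm (y - c) < rho ->
    `|g x - g y| <= K' * enorm (x - y).
Proof.
move=> [r r0 [K K0 Hb]] [q q0 [M M0 Hc]].
have [bc|bc] := eqVneq b c.
  exists r => //; exists K => x y K' KK'; rewrite -bc => xr yr.
  by apply: (le_trans (Hb x y xr yr)); rewrite ler_wpM2r ?enorm_ge0// ltW.
have e0 := enorm_gt0 bc; set e := enorm (b - c) in e0.
pose Q := K * r + M * q + `|g b - g c|.
exists (Num.min (e / 3) (Num.min r q)).
  by rewrite !lt_min r0 q0 divr_gt0.
exists (3 * Q / e) => x y K' KK'.
rewrite !lt_min => /andP[xe /andP[xr _]] /andP[ye /andP[_ yq]].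
have xy : e / 3 <= enorm (x - y).
  have := enorm_tri x b c; have := enorm_tri y x c.
  by rewrite (enormC b x) -/e; lra.
have h1 : `|g x - g b| <= K * r.
  apply: (le_trans (Hb x b xr _)); first by rewrite subrr enorm0.
  by rewrite ler_wpM2l// ltW.
have h2 : `|g c - g y| <= M * q.
  apply: (le_trans (Hc c y _ yq)); first by rewrite subrr enorm0.
  by rewrite ler_wpM2l// enormC ltW.
have gxy : `|g x - g y| <= Q.
  have := ler_distD (g b) (g x) (g y); have := ler_distD (g c) (g b) (g y).
  by rewrite /Q; lra.
have Q0 : 0 <= Q by rewrite (le_trans _ gxy).
have K'0 : 0 <= K' by rewrite (le_trans _ (ltW KK'))// divr_ge0 ?mulr_ge0// ltW.
apply: (le_trans gxy); apply: (@le_trans _ _ (K' * (e / 3))); last by rewrite ler_wpM2l.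
have := ltW KK'; rewrite ler_pdivrMr//; lra.
Qed.

(** Compactness of the product of the ball with itself gives one constant for all pairs, close or
    far apart. *)
Lemma lip_near_compact (g : V -> Y) (a : V) (r : R) :
  (forall b, enorm (b - a) <= r -> lip_near g b) ->
  lip_on_set [set x | enorm (x - a) <= r] g.
Proof.
move=> gl; set B := [set x | enorm (x - a) <= r].
have cB : compact B by exact: compact_enorm_ball.
have : compact (B `*` B) by exact: compact_setX.
move=> /compact_near_coveringP/(_ R (pinfty_nbhs R)
  (fun K xy => `|g xy.1 - g xy.2| <= K * enorm (xy.1 - xy.2)) _) [].
  move=> [b c] /= [Bb Bc].
  have [rho rho0 [K HK]] := lip_near_pair (gl b Bb) (gl c Bc).
  exists ([set xy | enorm (xy.1 - b) < rho /\ enorm (xy.2 - c) < rho], [set K' | K < K']).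
    split; last by exists K; split => //; exact: num_real.
    exists ([set x | enorm (x - b) < rho], [set y | enorm (y - c) < rho]).
      by split; exact: nbhs_enorm.
    by move=> [x y] /= [].
  by move=> [[x y] K'] /= [[xb yc] KK']; exact: HK.
move=> M [_ HM]; exists (M + 1) => x y Bx By.
by apply: (HM (M + 1) _ (x, y)) => //; rewrite ltrDl.
Qed.

End LocallyLipschitz.

(** * The extension *)

Section Rearrangements.
Context {Z : zmodType}.
Implicit Types a b c u v x y q r : Z.

Lemma addr_sub_split b c a u v : b + c - (a + (u + v)) = (b - a - u) + (c - v).
Proof. by rewrite !opprD !addrA (ACl (1*3*4*2*5)%AC). Qed.

Lemma sub_through x y q r u v a :
  x - y - (u - v + a) = (x - (q + u)) - (y - (r + v)) + (q - r - a).
Proof.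
rewrite [RHS](_ : _ = x - q - u - y + r + v + q - r - a); last first.
  by rewrite !opprD !opprK !addrA.
rewrite (ACl (1*4*3*6*9*2*7*5*8)%AC) /= subrK addrK.
by rewrite !opprD opprK !addrA.
Qed.

End Rearrangements.

Section Extension.
Context {R : realType} {n : nat} {Y : normedModType R}.
Local Notation V := 'rV[R]_n.
Variables (F : set V) (f : V -> Y).
Variables (w : nat -> V -> R) (p : nat -> V) (d : nat -> R) (delta : V -> R).
Variable C : R.
Hypothesis W : whitney F w p d delta C.
Variable idx : V -> seq nat.
Hypothesis idxP : forall x, ~ F x ->
  [/\ uniq (idx x), (size (idx x))%:R <= C &
    forall y, enorm (x - y) < delta x / C ->
      [/\ ~ F y, \sum_(j <- idx x) w j y = 1,
        forall j, j \notin idx x -> w j y = 0 &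
        forall j, `|w j x - w j y| <= C * (enorm (x - y) / delta x)]].
Variable A : nat -> {linear V -> Y}.

Definition piece (j : nat) (x : V) : Y := f (p j) + A j (x - p j).

Definition ext (x : V) : Y :=
  if `[< F x >] then f x else \sum_(j <- idx x) w j x *: piece j x.

Let C1 : 1 <= C := whitney_ge1 W.
Let C0 : 0 < C. Proof. exact: lt_le_trans ltr01 C1. Qed.

Lemma ext_in x : F x -> ext x = f x.
Proof. by rewrite /ext; case: asboolP. Qed.

Lemma idx_refl x : ~ F x -> enorm (x - x) < delta x / C.
Proof.
by move=> Fx; rewrite subrr enorm0 divr_gt0// (whitney_delta_gt0 W).
Qed.

(** The list in [ext] varies with the point, but that of [x] contains all indices active on a ball
    around [x]. *)
Lemma ext_local x y : ~ F x -> enorm (x - y) < delta x / C ->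
  ext y = \sum_(j <- idx x) w j y *: piece j y.
Proof.
move=> Fx xy; have [ux _ /(_ y xy)[Fy _ x0 _]] := idxP Fx.
have [uy _ /(_ y (idx_refl Fy))[_ _ y0 _]] := idxP Fy.
rewrite /ext; case: asboolP => // _.
by apply: big_uniq_support => // j; [move/y0|move/x0] => ->; rewrite scale0r.
Qed.

Lemma sum_weight_bound (s : seq nat) x (v : nat -> Y) (b : R) : ~ F x ->
  \sum_(j <- s) w j x = 1 -> (forall j, w j x != 0 -> `|v j| <= b) ->
  `|\sum_(j <- s) w j x *: v j| <= b.
Proof.
move=> Fx s1 vb; rewrite -[leRHS]mul1r -s1 mulr_suml.
apply: (le_trans (ler_norm_sum _ _ _)); apply: ler_sum => j _.
have [->|wj] := eqVneq (w j x) 0; first by rewrite scale0r normr0 mul0r.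
by rewrite normrZ ger0_norm ?(whitney_ge0 W)// ler_wpM2l ?(whitney_ge0 W)// vb.
Qed.

(** Off [F] the value [ext x] is a convex combination of the active pieces. *)
Lemma ext_sub_le x (z : Y) (b : R) : ~ F x ->
  (forall j, w j x != 0 -> `|piece j x - z| <= b) -> `|ext x - z| <= b.
Proof.
move=> Fx h; have [_ _ /(_ x (idx_refl Fx))[_ s1 _ _]] := idxP Fx.
rewrite (ext_local Fx (idx_refl Fx)) -[z]scale1r -s1 scaler_suml -sumrB.
under eq_bigr do rewrite -scalerBr.
exact: sum_weight_bound.
Qed.

Lemma exists_active x : ~ F x -> exists j, w j x != 0.
Proof.
move=> Fx; have [_ _ /(_ x (idx_refl Fx))[_ s1 _ _]] := idxP Fx.
apply: contrapT => h; have := oner_neq0 R; rewrite -s1 big1 ?eqxx// => j _.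
by apply/eqP; apply: contra_notT h => wj; exists j.
Qed.

Lemma active_close x j : ~ F x -> w j x != 0 ->
  enorm (x - p j) <= C ^+ 2 * delta x.
Proof.
move=> Fx wj; have [h1 h2] := whitney_supp W Fx wj.
by apply: (le_trans h1); rewrite expr2 -mulrA ler_wpM2l// ltW.
Qed.

Lemma active_geometry x a j : ~ F x -> F a -> w j x != 0 ->
  [/\ d j <= C * enorm (x - a), enorm (x - p j) <= C ^+ 2 * enorm (x - a) &
      enorm (p j - a) <= 2 * C ^+ 2 * enorm (x - a)].
Proof.
move=> Fx Fa wj; have xa := whitney_delta_le W x Fa.
have h := active_close Fx wj; have [_ h2] := whitney_supp W Fx wj.
have xp : enorm (x - p j) <= C ^+ 2 * enorm (x - a).
  by apply: (le_trans h); rewrite ler_wpM2l ?sqr_ge0.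
split=> //; first by apply: (le_trans h2); rewrite ler_wpM2l// ltW.
apply: (le_trans (enorm_tri x _ _)); rewrite (enormC (p j)) -mulrA mulr_natl mulr2n.
by rewrite lerD// ler_peMl ?enorm_ge0// exprn_ege1.
Qed.

(** * Lipschitz estimate of [ext - T0], from control of the data on [S] to pairs in [U] *)

Section LipschitzEstimate.
Variables (T0 : {linear V -> Y}) (e : R) (S U : set V).
Hypothesis e0 : 0 <= e.
Hypothesis active_in : forall x j, U x -> ~ F x -> w j x != 0 ->
  S (p j) /\ op_le (fun v => A j v - T0 v) e.
Hypothesis f_lip : forall q r, S q -> S r -> `|f q - f r - T0 (q - r)| <= e * enorm (q - r).
Hypothesis FS : forall x, U x -> F x -> S x.

Lemma piece_dev j x q : S (p j) -> op_le (fun v => A j v - T0 v) e -> S q ->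
  `|piece j x - (f q + T0 (x - q))| <= e * (enorm (p j - q) + enorm (x - p j)).
Proof.
move=> Sp Aj Sq.
have -> : piece j x - (f q + T0 (x - q)) =
    (f (p j) - f q - T0 (p j - q)) + (A j (x - p j) - T0 (x - p j)).
  rewrite -addr_sub_split -linearD /piece.
  by rewrite [p j - q + _]addrC subrKA.
apply: (le_trans (ler_normD _ _)); rewrite mulrDr.
by apply: lerD; [exact: f_lip|exact: Aj].
Qed.

Lemma ext_anchor x : U x -> ~ F x -> exists q,
  [/\ S q, enorm (x - q) <= C ^+ 2 * delta x &
     `|ext x - (f q + T0 (x - q))| <= 3 * C ^+ 2 * delta x * e].
Proof.
move=> Ux Fx; have [j0 wj0] := exists_active Fx.
have [Sq _] := active_in Ux Fx wj0; have q0 := active_close Fx wj0.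
exists (p j0); split=> //; apply: ext_sub_le => // j wj.
have [Sp Aj] := active_in Ux Fx wj; have qj := active_close Fx wj.
apply: (le_trans (piece_dev x Sp Aj Sq)); rewrite mulrC ler_wpM2r//.
have := enorm_tri x (p j) (p j0); rewrite (enormC (p j) x); lra.
Qed.

Lemma ext_lip_close x y : U x -> U y -> ~ F x -> enorm (x - y) < delta x / C ->
  `|ext x - ext y - T0 (x - y)| <= (1 + 7 * C ^+ 6) * e * enorm (x - y).
Proof.
move=> Ux Uy Fx xy; have [q [Sq xq _]] := ext_anchor Ux Fx.
have [us sC sP] := idxP Fx; have [Fy s1y _ wL] := sP y xy.
have [_ s1x _ _] := sP x (idx_refl Fx).
have dx0 := whitney_delta_gt0 W Fx; set z := f q + T0 (x - q).
have xyd : enorm (x - y) <= delta x.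
  by apply: (le_trans (ltW xy)); rewrite ler_pdivrMr// ler_peMr// ltW.
have C21 : 1 <= C ^+ 2 by rewrite exprn_ege1.
(* The record only makes [delta] a lower bound for distances, so the values at [y] and [x] are
   compared through an active point [p j0]. *)
have dy : delta y <= 2 * C ^+ 2 * delta x.
  have [j0 wj0] := exists_active Fx.
  apply: (le_trans (whitney_delta_le W y (whitney_point W j0))).
  have := enorm_tri x y (p j0); rewrite (enormC y x).
  have := active_close Fx wj0.
  have : 1 * delta x <= C ^+ 2 * delta x by rewrite ler_wpM2r// ltW.
  by lra.
have dev j : w j x != 0 \/ w j y != 0 ->
    `|piece j x - z| <= 7 * C ^+ 4 * e * delta x.
  move=> wj.
  have [Sp Aj] : S (p j) /\ op_le (fun v => A j v - T0 v) e.
    by case: wj => wj; [exact: active_in wj|exact: active_in wj].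
  have xp : enorm (x - p j) <= 3 * C ^+ 4 * delta x.
    have C42 : C ^+ 2 <= C ^+ 4 by rewrite ler_weXn2l.
    have C4d : C ^+ 2 * delta x <= C ^+ 4 * delta x by rewrite ler_wpM2r// ltW.
    have d1 : 1 * delta x <= C ^+ 2 * delta x by rewrite ler_wpM2r// ltW.
    case: wj => wj; first by have := active_close Fx wj; lra.
    have := active_close Fy wj; have := enorm_tri y x (p j).
    have : C ^+ 2 * delta y <= C ^+ 2 * (2 * C ^+ 2 * delta x).
      by rewrite ler_wpM2l ?sqr_ge0.
    have -> : C ^+ 2 * (2 * C ^+ 2 * delta x) = 2 * C ^+ 4 * delta x by ring.
    by lra.
  apply: (le_trans (piece_dev x Sp Aj Sq)).
  rewrite [leRHS](_ : _ = e * (7 * C ^+ 4 * delta x)); last by ring.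
  rewrite ler_wpM2l//; have := enorm_tri x (p j) q; rewrite (enormC (p j) x).
  have C42 : C ^+ 2 <= C ^+ 4 by rewrite ler_weXn2l.
  have : C ^+ 2 * delta x <= C ^+ 4 * delta x by rewrite ler_wpM2r// ltW.
  by lra.
(* The differences of weights sum to zero, so the common affine value [z] may be subtracted from
   every piece. The second sum has at most [C] terms, each at most [C * (|x - y| / delta x)] times
   [7 * C ^+ 4 * e * delta x], whence [7 * C ^+ 6]. *)
have -> : ext x - ext y - T0 (x - y) =
    \sum_(j <- idx x) w j y *: (A j (x - y) - T0 (x - y)) +
    \sum_(j <- idx x) (w j x - w j y) *: (piece j x - z).
  rewrite (ext_local Fx (idx_refl Fx)) (ext_local Fx xy).
  have sT : T0 (x - y) = \sum_(j <- idx x) w j y *: T0 (x - y).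
    by rewrite -scaler_suml s1y scale1r.
  rewrite {1}sT.
  have s0 : \sum_(j <- idx x) (w j x - w j y) = 0 by rewrite sumrB s1x s1y subrr.
  rewrite -sumrB -sumrB -big_split /=.
  have z0 : \sum_(j <- idx x) (w j x - w j y) *: z = 0.
    by rewrite -scaler_suml s0 scale0r.
  rewrite -[LHS]subr0 -[X in _ - X = _]z0 -sumrB; apply: eq_bigr => j _.
  have -> : piece j y = piece j x - A j (x - y).
    rewrite /piece -addrA -linearB; congr (_ + A j _).
    by rewrite opprB [RHS]addrC subrKA.
  rewrite !scalerBr !scalerBl !opprD !opprK !addrA.
  by rewrite (ACl (3*4*1*2*5*6)%AC).
apply: (le_trans (ler_normD _ _)); rewrite mulrDl mulrDl mul1r; apply: lerD.
  apply: sum_weight_bound => // j wj.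
  by have [_ Aj] := active_in Uy Fy wj; exact: Aj.
pose b := C * (enorm (x - y) / delta x) * (7 * C ^+ 4 * e * delta x).
have b0 : 0 <= b.
  by rewrite !mulr_ge0 ?invr_ge0 ?exprn_ge0 ?enorm_ge0// ltW.
apply: (@le_trans _ _ (\sum_(j <- idx x) b)).
  apply: (le_trans (ler_norm_sum _ _ _)); apply: ler_sum => j _.
  rewrite normrZ.
  have [wx|wx] := eqVneq (w j x) 0; have [wy|wy] := eqVneq (w j y) 0.
  - by rewrite wx wy subrr normr0 mul0r.
  - by apply: ler_pM => //; apply: dev; right.
  - by apply: ler_pM => //; apply: dev; left.
  - by apply: ler_pM => //; apply: dev; left.
rewrite big_const_seq count_predT iter_addr_0 -[leLHS]mulr_natl.
apply: (@le_trans _ _ (C * b)); first by rewrite ler_wpM2r.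
have -> : C * b = 7 * C ^+ 6 * e * enorm (x - y).
  by rewrite /b; field; rewrite gt_eqF.
by [].
Qed.

(** Leaving [S] and [U] free lets one estimate serve for strictness ([T0 = L a]) and, with [T0 = 0],
    for Lipschitz bounds near a point of [F], near a point off [F], and globally. For distant pairs
    the two anchors cost [3 * C ^+ 3] each and their mutual distance [1 + 2 * C ^+ 3]; the constant
    adds the bound of the close case. *)
Lemma ext_lip x y : U x -> U y ->
  `|ext x - ext y - T0 (x - y)| <= (1 + 8 * C ^+ 3 + 7 * C ^+ 6) * e * enorm (x - y).
Proof.
move=> Ux Uy.
have Cn m : 0 <= C ^+ m by rewrite exprn_ge0// ltW.
have small : (1 + 7 * C ^+ 6) * e * enorm (x - y) <=
   (1 + 8 * C ^+ 3 + 7 * C ^+ 6) * e * enorm (x - y).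
  by rewrite ler_wpM2r ?enorm_ge0// ler_wpM2r//; have := Cn 3; lra.
have [[Fx xy]|nx] := pselect (~ F x /\ enorm (x - y) < delta x / C).
  by apply: le_trans small; exact: ext_lip_close.
have [[Fy xy]|ny] := pselect (~ F y /\ enorm (x - y) < delta y / C).
  apply: le_trans small.
  have -> : ext x - ext y - T0 (x - y) = - (ext y - ext x - T0 (y - x)).
    by rewrite opprB opprB -[y - x]opprB linearN addrC.
  by rewrite normrN enormC; apply: ext_lip_close; rewrite // enormC.
have anchor u : U u -> (~ (~ F u /\ enorm (x - y) < delta u / C)) -> exists q,
    [/\ S q, enorm (u - q) <= C ^+ 3 * enorm (x - y) &
     `|ext u - (f q + T0 (u - q))| <= 3 * C ^+ 3 * enorm (x - y) * e].
  move=> Uu nu; have [Fu|Fu] := pselect (F u).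
    exists u; split; first exact: FS.
      by rewrite subrr enorm0 mulr_ge0 ?Cn ?enorm_ge0.
    by rewrite ext_in// subrr linear0 addr0 subrr normr0 !mulr_ge0 ?enorm_ge0// ltW.
  have [q [Sq uq eq]] := ext_anchor Uu Fu; exists q.
  have du : delta u <= C * enorm (x - y).
    rewrite mulrC -ler_pdivrMr// leNgt; apply/negP => h.
    by apply: nu.
  split=> //.
    by apply: (le_trans uq); rewrite (exprSr C 2) -mulrA ler_wpM2l.
  apply: (le_trans eq); rewrite ler_wpM2r// (exprSr C 2) -!mulrA ler_wpM2l//.
  by rewrite !ler_pM2l.
have [q [Sq xq eq]] := anchor x Ux nx; have [r [Sr yr er]] := anchor y Uy ny.
have -> : ext x - ext y - T0 (x - y) = (ext x - (f q + T0 (x - q))) -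
    (ext y - (f r + T0 (y - r))) + (f q - f r - T0 (q - r)).
  rewrite -sub_through -linearB -linearD; congr (_ - T0 _).
  by rewrite opprB !addrA [RHS](ACl (1*4*2*5*3*6)%AC) /= subrK addrK.
apply: (le_trans (ler_normD _ _)); have fqr := f_lip Sq Sr.
have n1 := ler_normB (ext x - (f q + T0 (x - q))) (ext y - (f r + T0 (y - r))).
have qr : enorm (q - r) <= enorm (x - y) + 2 * C ^+ 3 * enorm (x - y).
  have := enorm_tri x q r; have := enorm_tri y x r; rewrite (enormC q x); lra.
have eqr : e * enorm (q - r) <= e * (enorm (x - y) + 2 * C ^+ 3 * enorm (x - y)).
  by rewrite ler_wpM2l.
have : 0 <= 7 * C ^+ 6 * e * enorm (x - y).
  by rewrite mulr_ge0 ?enorm_ge0// mulr_ge0// mulr_ge0.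
by lra.
Qed.

End LipschitzEstimate.


Lemma ext_flat_combination x : ~ F x -> exists2 h, is_flat_combination h &
  \forall y \near x, ext y = h y.
Proof.
move=> Fx; exists (fun y => \sum_(j <- idx x) w j y *: piece j y); last first.
  near=> y; apply: ext_local => //; rewrite enormC; near: y; apply: nbhs_enorm.
  by rewrite divr_gt0// (whitney_delta_gt0 W).
apply: is_flat_combination_sum => j.
have wE := whitney_flat W j.
(* Coefficients of an affine map: [None] stands for the constant term, [Some i] for a coordinate. *)
pose v (i : option 'I_n) :=
  if i is Some i then A j (delta_mx ord0 i) else f (p j) - A j (p j).
pose c (i : option 'I_n) (y : V) := w j y * (if i is Some i then y ord0 i else 1).
have -> : (fun y => w j y *: piece j y) =
    (fun y => \sum_(i <- None :: [seq Some i | i <- index_enum 'I_n]) c i y *: v i).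
  apply/funext => y; rewrite big_cons big_map /c /v mulr1 /piece linearB /=.
  have -> : A j y = \sum_(i < n) y ord0 i *: A j (delta_mx ord0 i).
    rewrite {1}(row_sum_delta y) linear_sum /=.
    by apply: eq_bigr => i _; rewrite linearZ.
  rewrite addrCA scalerDr [LHS]addrC; congr (_ + _).
  by rewrite scaler_sumr; apply: eq_bigr => i _; rewrite scalerA.
apply: is_flat_combination_sum => i; apply: is_flat_combination_term.
apply: flat_algebraM => //; case: i => [i|]; first exact: flat_algebra_coord.
exact: flat_algebra_cst.
Unshelve. all: by end_near. Qed.

Lemma ext_smooth : open (~` F) -> smooth_on_open (~` F) ext.
Proof.
by move=> oF; apply: smooth_of_flat_combination => // x; exact: ext_flat_combination.
Qed.

Lemma ext_differential x : ~ F x -> exists D : {linear V -> Y},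
  forall eps : R, 0 < eps -> exists2 r : R, 0 < r & forall y, enorm (y - x) < r ->
    `|ext y - ext x - D (y - x)| <= eps * enorm (y - x).
Proof.
move=> Fx; have [h [u uE hu] eh] := ext_flat_combination Fx.
have [du _] := flat_combination_derive uE.
exists ('d (flat_combination u) x) => eps eps0.
have [r r0 Hr] := differentiable_enorm (du x) eps0.
have /nbhs_ballP[r' /= r'0 Hr'] := eh.
exists (Num.min r r') => [|y]; first by rewrite lt_min r0.
rewrite lt_min => /andP[yr yr']; rewrite (nbhs_singleton eh) Hr'.
  by rewrite !hu; exact: Hr.
rewrite -ball_normE /= distrC; exact: le_lt_trans (norm_le_enorm _) yr'.
Qed.

(** * Behaviour of the extension near points of [F] *)

Variables (L : V -> {linear V -> Y}) (s : nat -> R).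
Hypothesis s_gt0 : forall j, 0 < s j.
Hypothesis dE : forall j, d j = s j ^+ 4.
Hypothesis A_close : forall a (eps : R), F a -> 0 < eps ->
  exists2 sigma : R, 0 < sigma & forall j, s j < sigma -> forall v,
    `|A j v - L a v| * s j ^+ 4 <= eps * (enorm (p j - a) + s j ^+ 4) * enorm v.
Hypothesis A_cases : forall j,
  (exists q, [/\ F q, enorm (q - p j) <= s j ^+ 2 & A j = L q]) \/
  (~ op_le (L (p j)) (s j)^-1 /\ A j = \0).

(** Since [s j ^+ 4 = d j <= C * |x - a|], the active scales shrink with [|x - a|], as do the
    distances of the active points from [a]. *)
Lemma active_near a (rho : R) : F a -> 0 < rho -> exists2 r : R, 0 < r &
  forall x j, ~ F x -> enorm (x - a) < r -> w j x != 0 ->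
    [/\ enorm (p j - a) < rho, s j < rho & s j ^+ 2 < rho].
Proof.
move=> Fa rho0; pose m := Num.min rho 1.
have m0 : 0 < m by rewrite lt_min rho0 ltr01.
have C20 : 0 < 2 * C ^+ 2 by rewrite mulr_gt0// exprn_gt0.
exists (Num.min (rho / (2 * C ^+ 2)) (m ^+ 4 / C)).
  by rewrite lt_min !divr_gt0// exprn_gt0.
move=> x j Fx; rewrite lt_min ltr_pdivlMr// ltr_pdivlMr// => /andP[xa1 xa2] wj.
have [dj _ pa] := active_geometry Fx Fa wj.
have sm : s j < m.
  rewrite -(ltr_pXn2r (n := 4))// ?nnegrE ?ltW// -dE.
  by apply: (le_lt_trans dj); rewrite mulrC.
move: sm; rewrite lt_min => /andP[sr s1]; split=> //.
  by apply: (le_lt_trans pa); rewrite mulrC.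
by apply: le_lt_trans sr; rewrite expr2 ler_piMr// ltW.
Qed.

(** The bound [|x - p j| <= C * d j] cancels the factor [s j ^+ 4 = d j] of [A_close]. The constant
    [3 * C ^+ 3] is this [C] times [3 * C ^+ 2], which comes from [|p j - a| + d j]. *)
Lemma A_near a (eps : R) : F a -> 0 < eps -> exists2 rho : R, 0 < rho &
  forall x j, ~ F x -> enorm (x - a) < rho -> w j x != 0 ->
    `|A j (x - p j) - L a (x - p j)| <= eps * enorm (x - a).
Proof.
move=> Fa eps0; pose e := eps / (3 * C ^+ 3).
have C30 : 0 < 3 * C ^+ 3 by rewrite mulr_gt0// exprn_gt0.
have e0 : 0 < e by rewrite divr_gt0.
have [sigma sigma0 H] := A_close Fa e0.
have [r r0 Hr] := active_near Fa sigma0.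
exists r => // x j Fx xa wj; have [_ sj _] := Hr x j Fx xa wj.
have [dj _ pa] := active_geometry Fx Fa wj.
have [xp _] := whitney_supp W Fx wj.
have dj0 := whitney_size W j.
have := H j sj (x - p j); rewrite -dE => h.
rewrite -(ler_pM2r dj0); apply: (le_trans h).
apply: (@le_trans _ _ (e * (enorm (p j - a) + d j) * (C * d j))).
  by rewrite ler_wpM2l// mulr_ge0 ?(ltW e0)// addr_ge0 ?enorm_ge0// ltW.
rewrite mulrA ler_wpM2r ?(ltW dj0)//.
have CC : C * enorm (x - a) <= C ^+ 2 * enorm (x - a).
  by rewrite ler_wpM2r ?enorm_ge0// expr2 ler_peMr// ltW.
apply: (@le_trans _ _ (e * (3 * C ^+ 2 * enorm (x - a)) * C)).
  by rewrite ler_wpM2r ?(ltW C0)// ler_wpM2l ?(ltW e0)//; lra.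
rewrite le_eqVlt; apply/orP; left; apply/eqP; rewrite /e; field.
by rewrite gt_eqF.
Qed.

Lemma ext_near_affine a (eps : R) : F a -> 0 < eps -> exists2 rho : R, 0 < rho &
  forall x (b : R), ~ F x -> enorm (x - a) < rho ->
    (forall q, F q -> enorm (q - a) <= 2 * C ^+ 2 * enorm (x - a) ->
       `|f q - f a - L a (q - a)| <= b) ->
    `|ext x - f a - L a (x - a)| <= b + eps * enorm (x - a).
Proof.
move=> Fa eps0; have [rho rho0 H] := A_near Fa eps0.
exists rho => // x b Fx xa fb; rewrite -addrA -opprD.
apply: ext_sub_le => // j wj; have [_ _ pa] := active_geometry Fx Fa wj.
have -> : piece j x - (f a + L a (x - a)) =
    (f (p j) - f a - L a (p j - a)) + (A j (x - p j) - L a (x - p j)).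
  rewrite -addr_sub_split -linearD /piece.
  by rewrite [p j - a + _]addrC subrKA.
apply: (le_trans (ler_normD _ _)); apply: lerD; last exact: H.
exact: fb (whitney_point W j) pa.
Qed.

(** No derivative of [f] at [a] is assumed: by [A_near] the linear part of a piece differs little
    from [L a (x - p j)], so it is of order [|x - a|], which continuity and Hölder exponents up to 1
    tolerate. *)
Lemma ext_near_value a : F a -> exists2 M : R, 0 <= M & exists2 rho : R, 0 < rho &
  forall x (b : R), ~ F x -> enorm (x - a) < rho ->
    (forall q, F q -> enorm (q - a) <= 2 * C ^+ 2 * enorm (x - a) ->
       `|f q - f a| <= b) ->
    `|ext x - f a| <= b + M * enorm (x - a).
Proof.
move=> Fa; have [M M0 LM] := linear_bounded (L a).
have [rho rho0 H] := A_near Fa ltr01.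
have MC : 0 <= M * C ^+ 2 by rewrite mulr_ge0// exprn_ge0// ltW.
exists (1 + M * C ^+ 2); first by rewrite addr_ge0.
exists rho => // x b Fx xa fb.
apply: ext_sub_le => // j wj; have [_ xp pa] := active_geometry Fx Fa wj.
have -> : piece j x - f a = (f (p j) - f a) +
    (A j (x - p j) - L a (x - p j)) + L a (x - p j).
  by rewrite /piece -[RHS]addrA subrK addrAC.
have h1 := fb _ (whitney_point W j) pa; have h2 := H x j Fx xa wj.
have h3 := LM (x - p j).
have h4 : M * enorm (x - p j) <= M * (C ^+ 2 * enorm (x - a)) by rewrite ler_wpM2l.
apply: (le_trans (ler_normD _ _)).
have := ler_normD (f (p j) - f a) (A j (x - p j) - L a (x - p j)).
by lra.
Qed.



Lemma ext_continuous a : F a -> cont_at_rel F f a -> cont_at_rel setT ext a.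
Proof.
move=> Fa fa eps eps0; have [M M0 [rho rho0 H]] := ext_near_value Fa.
have e20 : 0 < eps / 2 by rewrite divr_gt0.
have [r r0 fr] := fa _ e20.
have C20 : 0 < 2 * C ^+ 2 by rewrite mulr_gt0// exprn_gt0.
have C21 : 1 <= C ^+ 2 by rewrite exprn_ege1.
have M10 : 0 < M + 1 by rewrite ltr_wpDl.
exists (Num.min rho (Num.min (r / (2 * C ^+ 2)) (eps / 2 / (M + 1)))).
  by rewrite !lt_min rho0 !divr_gt0.
move=> x _; rewrite !lt_min !ltr_pdivlMr// => /andP[x1 /andP[x2 x3]].
have x0 := enorm_ge0 (x - a); rewrite (ext_in Fa).
have [Fx|Fx] := pselect (F x).
  rewrite ext_in//; apply: (lt_trans (fr x Fx _)); last by lra.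
  apply: le_lt_trans x2; rewrite ler_peMr//; lra.
have := H x (eps / 2) Fx x1; rewrite mulrDr mulr1 in x3.
move=> /(_ _)/le_lt_trans; apply; last by lra.
move=> q Fq qa; apply: ltW; apply: fr => //; apply: (le_lt_trans qa).
by rewrite mulrC.
Qed.

Lemma ext_holder a (alpha : R) : F a -> 0 < alpha <= 1 ->
  holder_at F f a alpha -> holder_at setT ext a alpha.
Proof.
move=> Fa /andP[al0 al1] /holder_bound[K K0 [r r0 fr]].
have [M M0 [rho rho0 H]] := ext_near_value Fa.
set c := 2 * C ^+ 2; have c0 : 0 < c by rewrite mulr_gt0// exprn_gt0.
have C21 : 1 <= C ^+ 2 by rewrite exprn_ege1.
(* Distances below 1 satisfy [t <= t^alpha], which absorbs the linear term; [c^alpha] arises because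
   the active points are only within [c * t] of [a]. *)
right; exists (K * c `^ alpha + M + K); exists (Num.min 1 (Num.min rho (r / c))).
  by rewrite !lt_min rho0 divr_gt0// ltr01.
move=> x _; rewrite !lt_min ltr_pdivlMr// => /andP[x0 /andP[x1 /andP[x2 x3]]].
set t := enorm (x - a) in x0 x1 x2 x3 *.
have ta : 0 < t `^ alpha by exact: powR_gt0.
have Kc : 0 <= K * c `^ alpha by rewrite mulr_ge0// powR_ge0.
rewrite ler_pdivrMr// (ext_in Fa).
have Mt : 0 <= M * t `^ alpha by rewrite mulr_ge0// ltW.
have Kt : 0 <= K * t `^ alpha by rewrite mulr_ge0// ltW.
have Kct : 0 <= K * c `^ alpha * t `^ alpha by rewrite mulr_ge0// ltW.
have [Fx|Fx] := pselect (F x).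
  rewrite ext_in//; have := fr x Fx; rewrite -/t => /(_ _)/le_trans; apply; last by lra.
  apply: le_lt_trans x3; rewrite ler_peMr//; [exact: ltW|rewrite /c; lra].
have tt : t <= t `^ alpha.
  rewrite -{1}[t]powRr1; last exact: ltW.
  by apply: ger_powR => //; rewrite x0 ltW.
have := H x (K * (c * t) `^ alpha) Fx x2; rewrite -/t -/c => h.
apply: (le_trans (h _)).
  move=> q Fq qa; have qr : enorm (q - a) < r.
    by apply: (le_lt_trans qa); rewrite mulrC.
  apply: (le_trans (fr q Fq qr)); rewrite ler_wpM2l//.
  have ct : 0 <= c * t by rewrite mulr_ge0 ?enorm_ge0// ltW.
  by apply: ge0_ler_powR; rewrite ?nnegrE ?enorm_ge0// ltW.
rewrite powRM ?(ltW c0) ?(ltW x0)//.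
have : M * t <= M * t `^ alpha by rewrite ler_wpM2l.
lra.
Qed.

Lemma ext_frechet a : F a -> frechet_at F f a (L a) -> frechet_at setT ext a (L a).
Proof.
move=> Fa /frechet_bound fa; apply: bound_frechet => eps eps0.
set c := 2 * C ^+ 2; have c0 : 0 < c by rewrite mulr_gt0// exprn_gt0.
have C21 : 1 <= C ^+ 2 by rewrite exprn_ege1.
have c1 : 1 <= c by rewrite /c; lra.
have e0 : 0 < eps / (2 * c) by rewrite divr_gt0// mulr_gt0.
have e20 : 0 < eps / 2 by rewrite divr_gt0.
have [r r0 fr] := fa _ e0; have [rho rho0 H] := ext_near_affine Fa e20.
exists (Num.min rho (r / c)); first by rewrite lt_min rho0 divr_gt0.
move=> x; rewrite lt_min ltr_pdivlMr// => /andP[x1 x2]; rewrite (ext_in Fa).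
set t := enorm (x - a) in x1 x2 *; have t0 : 0 <= t := enorm_ge0 _.
have ec : eps / (2 * c) * (c * t) = eps / 2 * t by field; rewrite gt_eqF.
have [Fx|Fx] := pselect (F x).
  rewrite ext_in//; have tct : t <= c * t by rewrite ler_peMl.
  apply: (le_trans (fr x Fx _)); first by apply: le_lt_trans x2; rewrite mulrC.
  have : eps / (2 * c) * t <= eps / (2 * c) * (c * t) by rewrite ler_wpM2l ?(ltW e0).
  have := mulr_ge0 (ltW e20) t0; rewrite ec -/t; lra.
have := H x (eps / 2 * t) Fx x1; rewrite -/t -/c => h.
apply: (le_trans (h _)); last by lra.
move=> q Fq qa; have qr : enorm (q - a) < r.
  by apply: (le_lt_trans qa); rewrite mulrC.
by apply: (le_trans (fr q Fq qr)); rewrite -ec ler_wpM2l ?(ltW e0).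
Qed.

Lemma A_limit a : F a ->
  (forall eps : R, 0 < eps -> exists2 r : R, 0 < r & forall q, F q ->
     enorm (q - a) < r -> op_le (fun v => L q v - L a v) eps) ->
  forall eps : R, 0 < eps -> exists2 r : R, 0 < r & forall x j, ~ F x ->
    enorm (x - a) < r -> w j x != 0 -> op_le (fun v => A j v - L a v) eps.
Proof.
move=> Fa La eps eps0; have [r r0 Hr] := La eps eps0.
have [M M0 LM] := linear_bounded (L a).
have Me : 0 < M + eps by rewrite ltr_wpDl.
have rho0 : 0 < Num.min (r / 2) (M + eps)^-1 by rewrite lt_min divr_gt0// invr_gt0.
have [rho rho1 H] := active_near Fa rho0; exists rho => // x j Fx xa wj.
have [] := H x j Fx xa wj; rewrite !lt_min => /andP[pr _] /andP[_ sM] /andP[sr _].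
case: (A_cases j) => [[q [Fq qp ->]]|[nL _]].
  by apply: Hr => //; have := enorm_tri (p j) q a; lra.
(* The zero operator does not occur near [a]: there [L (p j)] is bounded by [M + eps], which is
   below [(s j)^-1]. *)
case: nL; apply: (@op_leW _ _ _ _ (M + eps)).
  by rewrite -[leLHS]invrK lef_pV2 ?posrE ?invr_gt0// ltW.
move=> v; have pa : enorm (p j - a) < r by lra.
have := Hr _ (whitney_point W j) pa v; have := LM v.
move=> h1 h2; rewrite -[L (p j) v](subrK (L a v)) mulrDl.
by apply: (le_trans (ler_normD _ _)); lra.
Qed.

Lemma A_bounded a (rho M : R) : F a -> 0 < rho -> 0 <= M ->
  (forall q, F q -> enorm (q - a) < rho -> op_le (L q) M) ->
  exists2 r : R, 0 < r & forall x j, ~ F x -> enorm (x - a) < r -> w j x != 0 ->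
    enorm (p j - a) < rho /\ op_le (A j) M.
Proof.
move=> Fa rho0 M0 LM; have rho2 : 0 < rho / 2 by rewrite divr_gt0.
have [r r0 H] := active_near Fa rho2; exists r => // x j Fx xa wj.
have [pr _ sr] := H x j Fx xa wj; split; first by lra.
case: (A_cases j) => [[q [Fq qp ->]]|[_ ->]].
  by apply: LM => //; have := enorm_tri (p j) q a; lra.
by move=> v; rewrite /= normr0 mulr_ge0 ?enorm_ge0.
Qed.

Lemma ext_strict a : F a ->
  (forall eps : R, 0 < eps -> exists2 r : R, 0 < r & forall q, F q ->
     enorm (q - a) < r -> op_le (fun v => L q v - L a v) eps) ->
  strict_at F f a (L a) -> forall eps : R, 0 < eps ->
  exists2 r : R, 0 < r & forall x y, enorm (x - a) < r -> enorm (y - a) < r ->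
    `|ext x - ext y - L a (x - y)| <= eps * enorm (x - y).
Proof.
move=> Fa La /strict_bound fa eps eps0.
pose K := 1 + 8 * C ^+ 3 + 7 * C ^+ 6.
have K0 : 0 < K by rewrite /K !addr_gt0// mulr_gt0// exprn_gt0.
have e0 : 0 < eps / K by rewrite divr_gt0.
have [r1 r10 H1] := fa _ e0; have [r2 r20 H2] := A_limit Fa La e0.
have [r3 r30 H3] := active_near Fa r10.
exists (Num.min r1 (Num.min r2 r3)); first by rewrite !lt_min r10 r20 r30.
move=> x y xr yr.
have := @ext_lip (L a) (eps / K) [set q | F q /\ enorm (q - a) < r1]
  [set z | enorm (z - a) < Num.min r1 (Num.min r2 r3)] (ltW e0) _ _ _ x y xr yr.
rewrite -/K [K * _]mulrC divfK ?gt_eqF//; apply.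
- move=> z j; rewrite /= !lt_min => /andP[_ /andP[z2 z3]] Fz wj; split.
    by split; [exact: whitney_point W j|have [] := H3 z j Fz z3 wj].
  exact: H2 z j Fz z2 wj.
- by move=> q z [Fq qa] [Fz za]; exact: H1.
- by move=> z; rewrite /= !lt_min => /andP[z1 _] Fz.
Qed.

Lemma ext_lip_near_in a (rho M : R) : F a -> 0 < rho -> 0 <= M ->
  (forall q, F q -> enorm (q - a) < rho -> op_le (L q) M) ->
  (forall x y, F x -> F y -> enorm (x - a) < rho -> enorm (y - a) < rho ->
     `|f x - f y| <= M * enorm (x - y)) ->
  lip_near ext a.
Proof.
move=> Fa rho0 M0 LM fM; have [r r0 H] := A_bounded Fa rho0 M0 LM.
pose K := 1 + 8 * C ^+ 3 + 7 * C ^+ 6.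
have K0 : 0 <= K by rewrite /K !addr_ge0// mulr_ge0// exprn_ge0// ltW.
exists (Num.min r rho); first by rewrite lt_min r0 rho0.
exists (K * M) => [|x y xr yr]; first by rewrite mulr_ge0.
have := @ext_lip \0 M [set q | F q /\ enorm (q - a) < rho]
  [set z | enorm (z - a) < Num.min r rho] M0 _ _ _ x y xr yr.
rewrite /= subr0; apply.
- move=> z j; rewrite /= lt_min => /andP[zr _] Fz wj.
  have [pr Aj] := H z j Fz zr wj; split; first by split => //; exact: whitney_point W j.
  by move=> v; rewrite /= subr0.
- by move=> q z [Fq qa] [Fz za]; rewrite /= subr0; exact: fM.
- by move=> z; rewrite /= lt_min => /andP[_ zr] Fz.
Qed.

Lemma seq_bound (I : eqType) (t : seq I) (g : I -> R) :
  exists2 e : R, 0 <= e & forall i, i \in t -> g i <= e.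
Proof.
elim: t => [|i t [e e0 He]]; first by exists 0.
exists (Num.max e (g i)) => [|j]; first by rewrite le_max e0.
rewrite inE le_max => /predU1P[->|/He ->//]; by rewrite lexx orbT.
Qed.

(** Near [x] only the finitely many points [p j] with [j] in [idx x] enter, and any function is
    Lipschitz on a finite set; this set is the [S] of [ext_lip]. *)
Lemma ext_lip_near_out x : ~ F x -> lip_near ext x.
Proof.
move=> Fx; have [_ _ loc] := idxP Fx.
have r0 : 0 < delta x / C by rewrite divr_gt0// (whitney_delta_gt0 W).
have /choice[b Hb] : forall j, exists c, 0 <= c /\ op_le (A j) c.
  by move=> j; have [c c0 Hc] := linear_bounded (A j); exists c.
have [e1 e10 He1] := seq_bound (idx x) b.
have [e2 e20 He2] := seq_bound [seq (j, k) | j <- idx x, k <- idx x]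
  (fun jk => `|f (p jk.1) - f (p jk.2)| / enorm (p jk.1 - p jk.2)).
pose e := e1 + e2; have e0 : 0 <= e by rewrite addr_ge0.
pose K := 1 + 8 * C ^+ 3 + 7 * C ^+ 6.
have K0 : 0 <= K by rewrite /K !addr_ge0// mulr_ge0// exprn_ge0// ltW.
exists (delta x / C) => //; exists (K * e) => [|y z yr zr]; first by rewrite mulr_ge0.
have := @ext_lip \0 e [set q | exists2 j, j \in idx x & q = p j]
  [set z | enorm (z - x) < delta x / C] e0 _ _ _ y z yr zr.
rewrite /= subr0; apply.
- move=> u j; rewrite /= enormC => /loc[_ _ u0 _] Fu wj.
  have jx : j \in idx x by apply: contraNT wj => /u0 ->.
  split; first by exists j.
  move=> v; rewrite /= subr0; have [_ bj] := Hb j; apply: op_leW bj _.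
  by apply: (le_trans (He1 j jx)); rewrite lerDl.
- move=> _ _ [j jx ->] [k kx ->]; rewrite /= subr0.
  have [->|jk] := eqVneq (p j) (p k).
    by rewrite !subrr normr0 mulr_ge0 ?enorm_ge0.
  rewrite -ler_pdivrMr ?enorm_gt0//.
  have := He2 (j, k) (allpairs_f _ jx kx); rewrite /= => /le_trans; apply.
  by rewrite lerDr.
- by move=> u; rewrite /= enormC => /loc[].
Qed.

(** Around [b] in [F] the data are controlled on the ball of radius [Rad - |b - a|], and off [F]
    local Lipschitz continuity is automatic; compactness of the closed ball of radius [r] then gives
    one constant. *)
Lemma ext_lip_ball a (Rad M r : R) : r < Rad -> 0 <= M ->
  (forall q, F q -> enorm (q - a) < Rad -> op_le (L q) M) ->
  (forall x y, F x -> F y -> enorm (x - a) < Rad -> enorm (y - a) < Rad ->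
     `|f x - f y| <= M * enorm (x - y)) ->
  lip_on_set (eball a r) ext.
Proof.
move=> rR M0 LM fM.
have [K HK] : lip_on_set [set x | enorm (x - a) <= r] ext.
  apply: lip_near_compact => b br; have [Fb|Fb] := pselect (F b).
    have rho0 : 0 < Rad - enorm (b - a) by lra.
    have inR q : enorm (q - b) < Rad - enorm (b - a) -> enorm (q - a) < Rad.
      by have := enorm_tri b q a; lra.
    apply: (ext_lip_near_in Fb rho0 M0) => [q Fq qb|x y Fx Fy xb yb].
      by apply: LM => //; exact: inR.
    by apply: fM => //; exact: inR.
  exact: ext_lip_near_out.
by exists K => x y xr yr; apply: HK; rewrite /=; exact: ltW.
Qed.

Lemma ext_lip_global (M : R) : 0 <= M ->
  (forall q, F q -> op_le (L q) M) ->
  (forall x y, F x -> F y -> `|f x - f y| <= M * enorm (x - y)) ->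
  lip_on_set setT ext.
Proof.
move=> M0 LM fM; exists ((1 + 8 * C ^+ 3 + 7 * C ^+ 6) * M) => x y _ _.
have := @ext_lip \0 M F setT M0 _ _ _ x y I I.
rewrite /= subr0; apply=> //.
- move=> z j _ Fz wj; split; first exact: whitney_point W j.
  move=> v; rewrite /= subr0; case: (A_cases j) => [[q [Fq qp ->]]|[_ ->]].
    exact: LM.
  by rewrite /= normr0 mulr_ge0 ?enorm_ge0.
- by move=> q z Fq Fz; rewrite /= subr0; exact: fM.
Qed.

End Extension.

(** * Choice of the data and verification of the properties *)

Theorem theorem4p1 (R : realType) (n : nat) (Y : normedModType R)
  (F : set 'rV[R]_n) (f : 'rV[R]_n -> Y) (L : 'rV[R]_n -> {linear 'rV[R]_n -> Y}) :
  closed F -> baire_one_on F L ->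
  exists fbar : 'rV[R]_n -> Y,
    (* (i) *)
    (forall x, F x -> fbar x = f x) /\
    (* (ii) *)
    (forall a, F a -> cont_at_rel F f a -> cont_at_rel setT fbar a) /\
    (* (iii) *)
    (forall a (alpha : R), F a -> 0 < alpha <= 1 ->
       holder_at F f a alpha -> holder_at setT fbar a alpha) /\
    (forall a, F a -> lip_at_pt F f a -> lip_at_pt setT fbar a) /\
    (* (iv) *)
    (forall a, F a -> frechet_at F f a (L a) -> frechet_at setT fbar a (L a)) /\
    (* (v) *)
    smooth_on_open (~` F) fbar /\
    (* (vi) *)
    (forall a, F a -> opcont_at F L a -> strict_at F f a (L a) ->
       (exists D : 'rV[R]_n -> {linear 'rV[R]_n -> Y},
          (forall x, (~` F `|` [set a]) x -> frechet_at setT fbar x (D x)) /\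
          opcont_at (~` F `|` [set a]) D a) /\
       strict_at setT fbar a (L a)) /\
    (* (vii) *)
    (forall a (Rad : R), F a -> 0 < Rad ->
       op_bounded_on (eball a Rad `&` F) L ->
       lip_on_set (eball a Rad `&` F) f ->
       forall r : R, r < Rad -> lip_on_set (eball a r) fbar) /\
    (op_bounded_on F L -> lip_on_set F f -> lip_on_set setT fbar).
Proof.
move=> cF [Lk [Lk_c Lk_l]].
(* The Whitney construction starts from a point of [F]; for empty [F] the zero function serves. *)
have [F0|F0] := pselect (F !=set0); last first.
  have nF x : ~ F x by move=> Fx; apply: F0; exists x.
  exists (fun=> 0); do 5! (split; first by move=> x; have := nF x).
  split.
    apply: smooth_of_flat_combination; first exact: closed_openC.
    move=> x _; exists (fun=> 0); last by near=> y.
    by exists [::] => // y; rewrite /flat_combination big_nil.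
  split; first by move=> a /nF.
  split; first by move=> a Rad /nF.
  by move=> _ _; exists 0 => x y _ _; rewrite subrr normr0 mul0r.
have [w [p [d [delta [C W]]]]] := exists_whitney cF F0.
have /choice[idx idxP] : forall x, exists s : seq nat, ~ F x ->
    [/\ uniq s, (size s)%:R <= C &
      forall y, enorm (x - y) < delta x / C ->
      [/\ ~ F y, \sum_(j <- s) w j y = 1,
        forall j, j \notin s -> w j y = 0 &
        forall j, `|w j x - w j y| <= C * (enorm (x - y) / delta x)]].
  move=> x; have [Fx|Fx] := pselect (F x); first by exists [::].
  by have [s Hs] := whitney_local W Fx; exists s.
(* The fourth root of the size, so that [s], [s ^+ 2] and [s ^+ 4] are the separate scales of the
   selection. *)
pose s j := Num.sqrt (Num.sqrt (d j)).
have s_gt0 j : 0 < s j by rewrite !sqrtr_gt0 (whitney_size W).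
have dE j : d j = s j ^+ 4.
  by rewrite (exprM _ 2 2) !sqr_sqrtr ?sqrtr_ge0// ltW// (whitney_size W).
have Lk_cont k a : F a -> forall eps : R, 0 < eps ->
    exists2 r : R, 0 < r & forall x, F x -> enorm (x - a) < r ->
      op_le (fun v => Lk k x v - Lk k a v) eps.
  move=> Fa eps eps0; have [r r0 Hr] := Lk_c k a Fa eps eps0.
  by exists r => // x Fx xr; apply: opnorm_sub_le; exact: ltW (Hr x Fx xr).
have Lk_lim x : F x -> forall eps : R, 0 < eps -> exists N : nat,
    forall k, (N <= k)%N -> op_le (fun v => Lk k x v - L x v) eps.
  move=> Fx eps eps0; have [N HN] := Lk_l x Fx eps eps0.
  by exists N => k Nk; apply: opnorm_sub_le; exact: ltW (HN k Nk).
have /choice[A HA] : forall j, exists T, selected F L Lk (p j) (s j) T.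
  by move=> j; apply: exists_selected => //; exact: whitney_point W j.
have A_close a (eps : R) : F a -> 0 < eps ->
    exists2 sigma : R, 0 < sigma & forall j, s j < sigma -> forall v,
    `|A j v - L a v| * s j ^+ 4 <= eps * (enorm (p j - a) + s j ^+ 4) * enorm v.
  move=> Fa eps0; have [sigma s0 H] := selected_close Lk_cont Lk_lim Fa eps0.
  exists sigma => // j sj; apply: H => //; first exact: whitney_point W j.
  by rewrite s_gt0.
have A_cases j : (exists q, [/\ F q, enorm (q - p j) <= s j ^+ 2 & A j = L q]) \/
    (~ op_le (L (p j)) (s j)^-1 /\ A j = \0).
  case: (HA j) => [k q _ [Fq qp _ _] _ ->|q N _ Fq qp _ Nmin [[_ ->]|[NT ->]]].
  - by left; exists q.
  - by left; exists q.
  (* Were [L (p j)] bounded by [(s j)^-1], the point [p j] itself would compete for the minimal [N]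
     and force [N <= (s j)^-1 + 1]. *)
  right; split=> // h.
  have := Nmin (p j) (s j)^-1 (whitney_point W j); rewrite subrr enorm0 => /(_ _ _ h).
  rewrite sqr_ge0 invr_ge0 (ltW (s_gt0 j)) => /(_ isT isT).
  by rewrite leNgt NT.
have Lop a : opcont_at F L a -> forall eps : R, 0 < eps ->
    exists2 r : R, 0 < r & forall q, F q ->
      enorm (q - a) < r -> op_le (fun v => L q v - L a v) eps.
  move=> La eps eps0; have [r r0 Hr] := La eps eps0.
  by exists r => // q Fq qr; apply: opnorm_sub_le; exact: ltW (Hr q Fq qr).
have holder a al : F a -> 0 < al <= 1 -> holder_at F f a al ->
    holder_at setT (ext F f w p idx A) a al.
  exact: (ext_holder W idxP s_gt0 dE A_close).
exists (ext F f w p idx A); split; first by move=> x; exact: ext_in.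
split; first exact: (ext_continuous W idxP s_gt0 dE A_close).
split; first exact: holder.
split; first by move=> a Fa; apply: holder; rewrite // ltr01 lexx.
split; first exact: (ext_frechet W idxP s_gt0 dE A_close).
split; first by apply: (ext_smooth f W idxP); exact: closed_openC.
split.
  move=> a Fa /Lop La fa.
  have es := ext_strict W idxP s_gt0 dE A_cases Fa La fa.
  split; last by apply: bound_strict.
  have /choice[D0 HD0] : forall x, exists D : {linear 'rV[R]_n -> Y}, ~ F x ->
      forall eps : R, 0 < eps -> exists2 r : R, 0 < r & forall y, enorm (y - x) < r ->
      `|ext F f w p idx A y - ext F f w p idx A x - D (y - x)| <= eps * enorm (y - x).
    move=> x; have [Fx|Fx] := pselect (F x); first by exists \0.
    by have [D HD] := ext_differential f W idxP A Fx; exists D.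
  (* The domain in question meets [F] only in [a], where the strict estimate yields the derivative
     [L a]. *)
  pose D x := if `[< F x >] then L a else D0 x.
  have Din x : F x -> D x = L a by rewrite /D; case: asboolP.
  have Dout x : ~ F x -> D x = D0 x by rewrite /D; case: asboolP.
  exists D; split.
    move=> x [Fx|->]; first by rewrite Dout//; apply: bound_frechet; exact: HD0.
    rewrite Din//; apply: bound_frechet => eps eps0.
    have [r r0 Hr] := es eps eps0; exists r => // y yr.
    by apply: Hr => //; rewrite subrr enorm0.
  move=> eps eps0; have e0 : 0 < eps / 2 by rewrite divr_gt0.
  have [r r0 Hr] := es _ e0; exists r => // x Ax xr; rewrite (Din a Fa).
  apply: (@le_lt_trans _ _ (eps / 2)); last by lra.
  apply: le_opnorm; first exact: ltW.
  case: Ax => [Fx|->]; last first.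
    by move=> v; rewrite Din// subrr normr0 mulr_ge0 ?enorm_ge0// ltW.
  rewrite Dout//.
  (* The ball of radius [r - |x - a|] around [x] stays inside the ball of the strict estimate. *)
  apply: (linear_le_of_lip (rho := r - enorm (x - a)) (g := ext F f w p idx A) (x := x)); last exact: HD0.
  - by rewrite subr_gt0.
  - exact: ltW.
  move=> y yx; apply: Hr => //.
  by have := enorm_tri x y a; lra.
(* Both bounds are merged into one nonnegative constant, since [ext_lip] has a single [e]. *)
have bnd (S : set 'rV[R]_n) : op_bounded_on S L -> lip_on_set S f ->
    exists2 M : R, 0 <= M & (forall q, S q -> op_le (L q) M) /\
      forall x y, S x -> S y -> `|f x - f y| <= M * enorm (x - y).
  move=> [M HM] [K HK]; exists (`|M| + `|K|); first by rewrite addr_ge0.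
  split=> [q Sq|x y Sx Sy].
    apply: opnorm_le; apply: (le_trans (HM q Sq)); apply: (le_trans (ler_norm M)).
    by rewrite lerDl.
  apply: (le_trans (HK x y Sx Sy)); rewrite ler_wpM2r ?enorm_ge0//.
  by apply: (le_trans (ler_norm K)); rewrite lerDr.
split.
  move=> a Rad Fa Rad0 LM fM r rR; have [M M0 [HL Hf]] := bnd _ LM fM.
  apply: (ext_lip_ball W idxP s_gt0 dE A_cases rR M0).
    by move=> q Fq qa; exact: HL.
  by move=> x y Fx Fy xa ya; exact: Hf.
move=> LM fM; have [M M0 [HL Hf]] := bnd _ LM fM.
exact: (ext_lip_global W idxP A_cases M0 HL Hf).
Unshelve. all: by end_near. Qed.
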